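(* For a label $\mathcal M$ the following are equivalent. (a) The label $\mathcal M$ is bounded and WAP. (b) The cascade $(X(\mathcal M),S)$ is WAP. (c) The cascade $(X_+(\mathcal M),S)$ is WAP. In that case, $\Theta(\mathcal M)$ and $X(\mathcal M)$ are countable and $\mathcal M$ is of finite type.
   Context: Write $\mathbb N=\{1,2,\dots\}$. An $\mathbb N$-vector is a function $\mathbf m:\mathbb N\to\{0,1,2,\dots\}$ with finite support $\mathrm{supp}\,\mathbf m$; $FIN(\mathbb N)$ is the additive monoid of all $\mathbb N$-vectors, with identity $\mathbf 0$ and the pointwise order. A label is a set $\mathcal M\subset FIN(\mathbb N)$ such that $\mathbf 0\le\mathbf m_1\le\mathbf m\in\mathcal M$ implies $\mathbf m_1\in\mathcal M$. It is bounded if $\sup_{\mathbf m\in\mathcal M}\mathbf m_\ell<\infty$ for each $\ell$, and of finite type if it contains no infinite strictly increasing sequence. $\mathcal{LAB}$ is the compact space of all labels (including $\emptyset$) with the ultrametric $d(\mathcal M_1,\mathcal M_2)=\inf\{2^{-N}:N\ge0,\ \mathcal M_1\cap\mathcal B_N=\mathcal M_2\cap\mathcal B_N\}$, where $\mathcal B_N$ is the set of $\mathbb N$-vectors $\mathbf m$ with $\mathbf m_\ell<N$ for all $\ell$ and $\mathrm{supp}\,\mathbf m\subset[1,N]$. $FIN(\mathbb N)$ acts continuously on $\mathcal{LAB}$ by $P_{\mathbf r}(\mathcal M)=\mathcal M-\mathbf r=\{\mathbf w\in FIN(\mathbb N):\mathbf w+\mathbf r\in\mathcal M\}$. $\Theta(\mathcal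 M)$ is the closure of $\{\mathcal M-\mathbf r:\mathbf r\in FIN(\mathbb N)\}$, and $\mathcal E(\Theta(\mathcal M))$ is the closure of $\{P_{\mathbf r}|\Theta(\mathcal M):\mathbf r\in FIN(\mathbb N)\}$ in $\Theta(\mathcal M)^{\Theta(\mathcal M)}$ (pointwise convergence). The label $\mathcal M$ is WAP if every element of $\mathcal E(\Theta(\mathcal M))$ is continuous on $\Theta(\mathcal M)$. Fix an odd integer $b\ge5$ and a partition $\{D_\ell:\ell\in\mathbb N\}$ of $\mathbb N$ into infinite sets with $\min D_\ell<\min D_{\ell+1}$. Define $k:\mathbb Z\to\mathbb Z$ by $k(n)=b^{n-1}$ for $n\ge1$, $k(0)=0$, $k(-n)=-k(n)$. $IP(k)$ (resp. $IP_+(k)$) is the set of sums of finite subsets of $k(\mathbb Z)$ (resp. of $k(\{0,1,2,\dots\})$). Each $t\in IP(k)$ has a unique expansion $t=k(j_1)+\dots+k(j_r)$ with $|j_1|>\dots>|j_r|>0$ ($r=0$ for $t=0$); its length vector $\mathbf r(t)\in FIN(\mathbb N)$ is $\mathbf r(t)_\ell=\#\{i:|j_i|\in D_\ell\}$. For a label $\mathcal M$, $A[\mathcal M]=\{t\in IP(k):\mathbf r(t)\in\mathcal M\}$, $A_+[\mathcal M]=A[\mathcal M]\cap IP_+(k)$, and $x[\mathcal M],x_+[\mathcal M]\in\{0,1\}^{\mathbb Z}$ are the characteristic functions of $A[\mathcal M]$ and $A_+[\mathcal M]$. $S$ is the shift $S(x)_t=x_{t+1}$; $X(\mathcal M)$,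 $X_+(\mathcal M)$ are the orbit closures (under $S^n$, $n\in\mathbb Z$) of $x[\mathcal M]$, $x_+[\mathcal M]$. A cascade $(X,T)$ ($T$ a homeomorphism of a compact Hausdorff space $X$) is WAP if every element of its enveloping semigroup $E(X,T)$, the closure of $\{T^n:n\in\mathbb Z\}$ in $X^X$ (pointwise convergence), is continuous. *)

(* Defs.v *)
From HB Require Import structures.
From mathcomp Require Import all_boot all_order all_algebra.
From mathcomp Require Import finmap multiset.
From mathcomp Require Import all_classical all_reals all_analysis.
From mathcomp Require Import zify.

Set Implicit Arguments.
Unset Strict Implicit.
Unset Printing Implicit Defensive.

Import Order.TTheory GRing.Theory Num.Theory.

Local Open Scope classical_set_scope.
Local Open Scope ring_scope.

Record cont_action (G : nmodType) (X : topologicalType) := ContAction {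
  act :> G -> X -> X;
  act0 : act 0 = id;
  actD : forall g h, act (g + h) = act g \o act h;
  act_continuous : forall g, continuous (act g) }.

Section Action.
Context {G : nmodType} {X : topologicalType}.
Implicit Type a : cont_action G X.

Definition enveloping_semigroup a : set {ptws X -> X} :=
  closure (range (a : G -> {ptws X -> X})).

(* For G = int and X compact Hausdorff, an action is given by the integer powers
   of the homeomorphism a 1, and this is the notion of a WAP cascade. *)
Definition WAP a := forall f, enveloping_semigroup a f -> continuous (f : X -> X).

Definition orbit_closure a (x : X) : set X := closure (range (a^~ x)).

Lemma orbit_closure_stable a x g y :
  orbit_closure a x y -> orbit_closure a x (a g y).
Proof.
move=> xy B /(@act_continuous _ _ a g y) /xy[_ [[h _ <-] Bh]].
by exists (a (g + h) x); split; [exists (g + h) | rewrite actD].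
Qed.

End Action.

Section OrbitAction.
Context {G : nmodType} {X : topologicalType} (a : cont_action G X) (x : X).
Local Notation Y := (set_type (orbit_closure a x)).

Definition orbit_act (g : G) (y : Y) : Y :=
  SigSub (mem_set (@orbit_closure_stable _ _ a x g _ (set_mem (valP y)))).

Let orbit_act0 : orbit_act 0 = id.
Proof. by apply/funext => y; apply/val_inj; rewrite /= act0. Qed.

Let orbit_actD g h : orbit_act (g + h) = orbit_act g \o orbit_act h.
Proof. by apply/funext => y; apply/val_inj; rewrite /= actD. Qed.

Let orbit_act_continuous g : continuous (orbit_act g).
Proof.
apply: (@continuous_comp_initial Y Y X set_val) => y.
apply: (@continuous_comp Y X X set_val (a g)); last exact: act_continuous.
exact: initial_continuous.
Qed.

(* The action restricted to the orbit closure of x, with the topology of a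
   subspace of X. *)
Definition orbit_action : cont_action G Y :=
  ContAction orbit_act0 orbit_actD orbit_act_continuous.

End OrbitAction.

Notation posnat := {n : nat | (0 < n)%N}.

Section MsetNmodule.
Variable T : choiceType.

HB.instance Definition _ := Choice.copy {mset T}%mset (multiset T).
HB.instance Definition _ :=
  GRing.isNmodule.Build {mset T}%mset (@msetDA T) (@msetDC T) (@mset0D T).

End MsetNmodule.

(* A finitely supported function posnat -> nat is a finite multiset; the order
   of the multiset library is the pointwise one. *)
Notation Nvec := {mset posnat}%mset.

Lemma NvecD (m1 m2 : Nvec) l : (m1 + m2 : Nvec) l = (m1 l + m2 l)%N.
Proof. by rewrite /GRing.add /= msetE2. Qed.

Definition Nbox (N : nat) : set Nvec :=
  [set m : Nvec | forall l, (m l < N)%N /\ (l \in finsupp m -> (val l <= N)%N)].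

Lemma Nbox_mono N1 N2 : (N1 <= N2)%N -> Nbox N1 `<=` Nbox N2.
Proof.
move=> N12 m mN l; have [ml sl] := mN l; split=> [|/sl]; last by lia.
by lia.
Qed.

Lemma Nbox_exists (m : Nvec) : exists N, Nbox N m.
Proof.
exists (\sum_(l <- finsupp m) (val l + m l)).+1%N => l.
have [ls|ls] := boolP (l \in finsupp m); last by rewrite fsfun_dflt.
rewrite (big_rem l) //=; split; lia.
Qed.

Record label := Label {
  label_set :> set Nvec;
  label_down : forall m1 m, (m1 `<=` m)%mset -> label_set m -> label_set m1 }.

Lemma label_eqP (M1 M2 : label) : label_set M1 = label_set M2 -> M1 = M2.
Proof.
case: M1 M2 => [A hA] [B hB] /= AB; move: hA; rewrite AB => hA.
by congr Label; exact: Prop_irrelevance.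
Qed.

HB.instance Definition _ := gen_eqMixin label.
HB.instance Definition _ := gen_choiceMixin label.

(* The type of labels with the metric space structure given by label_dist below; the
   real numbers R matter only as the codomain of the distance. *)
Definition LAB (R : realType) : Type := label.

Definition label_agree (M1 M2 : label) (N : nat) :=
  M1 `&` Nbox N = M2 `&` Nbox N.

Section LabelMetric.
Variable R : realType.
Implicit Types M : label.

Definition label_dist M1 M2 : R :=
  inf [set e | exists2 N, label_agree M1 M2 N & e = 2^-1 ^+ N].

Let dist_set M1 M2 : set R :=
  [set e | exists2 N, label_agree M1 M2 N & e = 2^-1 ^+ N].

Let dist_has_inf M1 M2 : has_inf (dist_set M1 M2).
Proof.
split; last by exists 0 => _ [N _ ->]; rewrite exprn_ge0.
exists 1, 0%N; last by rewrite expr0.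
apply/seteqP; split=> m [_ m0]; exfalso; case: (m0 (exist _ 1%N isT)) => //.
Qed.

Lemma label_agree_mono M1 M2 N1 N2 : (N1 <= N2)%N ->
  label_agree M1 M2 N2 -> label_agree M1 M2 N1.
Proof.
move=> N12 e; rewrite /label_agree.
by rewrite -(setIidr (Nbox_mono N12)) !setIA -/(label_agree _ _ _) e.
Qed.

Lemma label_dist_lt M1 M2 e :
  label_dist M1 M2 < e <-> exists2 N, label_agree M1 M2 N & 2^-1 ^+ N < e.
Proof.
split.
  move=> /(inf_lt (dist_has_inf M1 M2).1)[_ [N a ->] ?].
  by exists N.
move=> [N a]; apply: le_lt_trans; apply: ge_inf; last by exists N.
by have [] := dist_has_inf M1 M2.
Qed.

Let dist_ge0 M1 M2 : 0 <= label_dist M1 M2.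
Proof.
apply: lb_le_inf; first by have [] := dist_has_inf M1 M2.
by move=> _ [N _ ->]; rewrite exprn_ge0.
Qed.

Lemma label_distxx M : label_dist M M = 0.
Proof.
apply/eqP; rewrite eq_le dist_ge0 andbT leNgt; apply/negP => d0.
suff [N hN] : exists N, 2^-1 ^+ N < label_dist M M.
  suff : label_dist M M < label_dist M M by rewrite ltxx.
  by apply/label_dist_lt; exists N.
have hh : `|2^-1 : R| < 1 by rewrite ger0_norm // invf_lt1 // ltr1n.
have /cvgrPdist_lt/(_ _ d0)[N _ /(_ N (leqnn _))] := cvg_expr hh.
by rewrite /= sub0r normrN ger0_norm ?exprn_ge0 // => ?; exists N.
Qed.

Let dist_positivity M1 M2 : label_dist M1 M2 = 0 -> M1 = M2.
Proof.
move=> d0; have agree N : label_agree M1 M2 N.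
  have : label_dist M1 M2 < 2^-1 ^+ N by rewrite d0 exprn_gt0.
  move=> /label_dist_lt[n a]; rewrite ltr_iXn2l ?invr_gt0 ?invf_lt1 ?ltr1n //.
  by move=> /ltnW /label_agree_mono; apply.
apply/label_eqP/seteqP; split=> m Mm; have [N mN] := Nbox_exists m.
  by have : (M1 `&` Nbox N) m by []; rewrite agree => -[].
by have : (M2 `&` Nbox N) m by []; rewrite -agree => -[].
Qed.

Let dist_sym M1 M2 : label_dist M1 M2 = label_dist M2 M1.
Proof.
congr inf; apply/seteqP; split=> e [N a ->]; exists N => //; exact: esym.
Qed.

Lemma label_dist_ultra M2 M1 M3 :
  label_dist M1 M3 <= Num.max (label_dist M1 M2) (label_dist M2 M3).
Proof.
rewrite leNgt gt_max; apply/negP => /andP[].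
move=> /label_dist_lt[N1 a1 l1] /label_dist_lt[N2 a2 l2].
suff : label_dist M1 M3 < label_dist M1 M3 by rewrite ltxx.
apply/label_dist_lt; exists (minn N1 N2); last by case: leqP.
exact: etrans (label_agree_mono (geq_minl _ _) a1)
              (label_agree_mono (geq_minr _ _) a2).
Qed.

Let dist_triangle M2 M1 M3 :
  label_dist M1 M3 <= label_dist M1 M2 + label_dist M2 M3.
Proof.
apply: le_trans (label_dist_ultra M2 M1 M3) _.
by rewrite ge_max lerDl lerDr !dist_ge0.
Qed.

HB.instance Definition _ := Choice.on (LAB R).
HB.instance Definition _ := @isMetric.Build R (LAB R) label_dist
  label_distxx dist_positivity dist_sym dist_triangle.

End LabelMetric.

Section LabelAction.
Implicit Types (M : label) (r : Nvec).

Lemma translate_down r M m1 m : (m1 `<=` m)%mset ->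
  label_set M (m + r) -> label_set M (m1 + r).
Proof.
move=> /msubsetP m1m; apply: label_down; apply/msubsetP => l.
by rewrite !NvecD leq_add2r.
Qed.

Definition label_translate r M : label := Label (@translate_down r M).

Variable R : realType.

Let translate0 : label_translate 0 = id.
Proof.
by apply/funext => M; apply/label_eqP/seteqP; split=> m /=; rewrite addr0.
Qed.

Let translateD (r s : Nvec) :
  label_translate (r + s) = label_translate r \o label_translate s.
Proof.
by apply/funext => M; apply/label_eqP/seteqP; split=> m /=; rewrite addrA.
Qed.

Let translate_continuous r :
  continuous (label_translate r : LAB R -> LAB R).
Proof.
have [K rK] := Nbox_exists r => M A /nbhs_ballP[e e0 eA]; apply/nbhs_ballP.
have /label_dist_lt[N _ Ne] : label_dist R (label_translate r M)
  (label_translate r M) < e by rewrite label_distxx.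
exists (2^-1 ^+ (N + K)); first exact: exprn_gt0.
move=> M'; rewrite ballEmdist /= => /label_dist_lt[n a].
rewrite ltr_iXn2l ?invr_gt0 ?invf_lt1 ?ltr1n // => /ltnW nK.
have {a} a := label_agree_mono nK a.
have box m : Nbox N m -> Nbox (N + K) (m + r).
  move=> mN l; have [ml sl] := mN l; have [rl tl] := rK l.
  move: sl tl; rewrite !mem_finsupp NvecD; lia.
apply: eA; rewrite ballEmdist /=; apply/label_dist_lt; exists N => //.
apply/seteqP; split=> m [/= Mm mN]; split=> //=.
  have : (M `&` Nbox (N + K)) (m + r) by split=> //; apply: box.
  by rewrite a => -[].
have : ((M' : label) `&` Nbox (N + K)) (m + r) by split=> //; apply: box.
by rewrite -a => -[].
Qed.

Definition label_action : cont_action Nvec (LAB R) :=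
  @ContAction Nvec (LAB R) label_translate
    translate0 translateD translate_continuous.

End LabelAction.

Definition Theta (R : realType) (M : label) : set (LAB R) :=
  orbit_closure (label_action R) M.
Arguments Theta : clear implicits.

Definition label_WAP (R : realType) (M : label) :=
  WAP (orbit_action (label_action R) M).

Definition label_bounded (M : label) :=
  forall l, exists K, forall m, label_set M m -> (m l <= K)%N.

Definition label_finite_type (M : label) :=
  ~ exists u : nat -> Nvec, forall i, label_set M (u i) /\ (u i `<` u i.+1)%mset.

Definition is_min (A : set nat) n := A n /\ forall i, A i -> (n <= i)%N.

Definition length_partition (D : posnat -> set nat) :=
  [/\ forall l, infinite_set (D l),
      trivIset setT D,
      \bigcup_l D l = [set n | (0 < n)%N] &
      forall l l' n n', val l' = (val l).+1 ->
        is_min (D l) n -> is_min (D l') n' -> (n < n')%N].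

Section Expansions.
Variables (b : nat) (D : posnat -> set nat).

Definition kseq (j : int) : int :=
  match j with
  | Posz 0 => 0
  | Posz n.+1 => b%:Z ^+ n
  | Negz n => - b%:Z ^+ n
  end.

Definition IP (J : set int) : set int :=
  [set t | exists2 F : {fset int}, [set` F] `<=` kseq @` J &
    t = \sum_(x <- F) x].

Definition expansion (js : seq int) (t : int) :=
  [/\ sorted gtn [seq `|j|%N | j <- js], all (fun j => j != 0) js &
      t = \sum_(j <- js) kseq j].

(* r is the length vector r(t), read off from the expansion of t. *)
Definition length_vector (t : int) (r : Nvec) :=
  exists2 js, expansion js t &
    forall l, r l = count (fun j => `|j|%N \in D l) js.

Definition label_ints (M : label) : set int :=
  [set t | IP setT t /\ exists2 r, length_vector t r & label_set M r].

Definition label_ints_pos (M : label) : set int :=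
  label_ints M `&` IP [set j | 0 <= j].

End Expansions.

Definition bitseqZ : Type := {ptws int -> bool}.
HB.instance Definition _ := Topological.on bitseqZ.

Definition char_seq (A : set int) : bitseqZ := fun t => t \in A.

Section Shift.

Definition shift (n : int) (x : bitseqZ) : bitseqZ := fun t => x (t + n).

Let shift0 : shift 0 = id.
Proof. by apply/funext => x; apply/funext => t; rewrite /shift addr0. Qed.

Let shiftD n m : shift (n + m) = shift n \o shift m.
Proof.
by apply/funext => x; apply/funext => t; rewrite /shift /= addrA.
Qed.

Let shift_continuous n : continuous (shift n).
Proof.
move=> x; apply/cvg_sup => t A [_ [[B oB <-] Bx] BA].
have nB : nbhs (x (t + n)) B by apply: open_nbhs_nbhs; split.
have h : nbhs (x : bitseqZ) (proj (t + n) @^-1` B).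
  exact: (@proj_continuous int (fun=> bool) (t + n) x B nB).
change (nbhs (x : bitseqZ) (shift n @^-1` A)).
by apply: filterS h => y By; exact: BA.
Qed.

(* The integer n acts by S^n, where S = shift 1. *)
Definition shift_action : cont_action int bitseqZ :=
  ContAction shift0 shiftD shift_continuous.

End Shift.

Definition X_of b D (M : label) : set bitseqZ :=
  orbit_closure shift_action (char_seq (label_ints b D M)).

Definition cascade_WAP b D (M : label) :=
  WAP (orbit_action shift_action (char_seq (label_ints b D M))).

Definition cascade_pos_WAP b D (M : label) :=
  WAP (orbit_action shift_action (char_seq (label_ints_pos b D M))).

(* Main.v *)
Require Import Defs.
From mathcomp Require Import all_boot all_order all_algebra.
From mathcomp Require Import finmap multiset.
From mathcomp Require Import all_classical all_reals all_analysis.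
From mathcomp Require Import zify ring.

Set Implicit Arguments.
Unset Strict Implicit.
Unset Printing Implicit Defensive.

Import Order.TTheory GRing.Theory Num.Theory.

Local Open Scope classical_set_scope.
Local Open Scope ring_scope.

(** Weak almost periodicity is decided here by one combinatorial property.  Say that a subset [A]
of a commutative monoid has the order property when there are sequences [g],
[h] such that [g i + h j] lies in [A] for [i < j] and outside [A] for [j < i].
Let a commutative monoid act on a compact space with a dense orbit, that of
[x], and let [f] be a continuous two-valued function whose translates generate
the topology.  By the double limit argument of Grothendieck, the system is WAP
iff the set of all [g] with [f (g x)] does not have the order property
([WAP_no_order], [no_order_WAP]).  For a label, with [f] the test for
membership of the zero vector, that set is the label itself; for the two
cascades, with [f] the coordinate at 0, it is [A[M]] or [A_+[M]].  So the
theorem compares the order property of [M] among the N-vectors with that of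
[A[M]] and [A_+[M]] among the integers.

Countability comes from the same source: without the order property, the
trace of a point of the orbit closure under [f] depends only on finitely many
translates of [x] ([trace_determined]; this is the definability of types over
a model of a stable formula), and a countable monoid has only countably many
such finite descriptions.

Finite type follows from boundedness and the absence of the order property
([bounded_stable_finite_type]).  An infinite increasing sequence in a bounded
label meets infinitely many coordinates.  For each fresh coordinate take the
largest multiple of its unit vector that still fits beside all terms of the
sequence; that multiple can be added to the early terms, where the coordinate
vanishes, but not to the late ones, where it does not.

Expansions are integer polynomials evaluated at [b].  As [b >= 5], digits of
absolute value at most 2 are determined by the value ([horner_inj_small]), so
sums and differences of two expansions involve no carries.  If [M] has the
order property, placing the vectors on disjoint sets of positions transfers it
to the integers ([order_label_ints]).  If [M] is unbounded on a class [D_l],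
then initial sums of powers with positions in [D_l], against single such powers,
have the order property, because a repeated position creates the digit 2
([unbounded_order]).  Conversely, let [t i + u j] exhibit the order property in
the integers.  After a translation making [t 0] vanish, the [u j] are
expansions and the [t i] are differences of two expansions; along an
ultrafilter their digits converge.  The limits of [u], and of the sum of [t]
and [u], have all their truncations in [M], so by finite type they are finite.
What remains after subtracting the limits moves off to infinity, so for a
sparse subsequence the supports are disjoint, length vectors add up, and [M]
has the order property ([order_digit_polys]). *)

(** * The order property and weak almost periodicity *)

(** A form of dependent choice for relations between pairs of terms: the next
term only has to be compatible with each of the finitely many terms already
chosen.  All sparse sequences below are extracted in this way. *)
Lemma pairwise_sequence (T : eqType) (Q : T -> Prop) (P : T -> T -> Prop) :
  (forall s : seq T, {in s, forall x, Q x} ->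
     exists2 x, Q x & {in s, forall y, P y x}) ->
  exists2 u : nat -> T, forall n, Q (u n) &
    forall i j, (i < j)%N -> P (u i) (u j).
Proof.
move=> step.
have [t0 _ _] := step [::] (fun _ => ltac:(by [])).
have [s|F FP] := @boolp.choice (seq T) T (fun s t => {in s, forall x, Q x} ->
    Q t /\ {in s, forall y, P y t}).
  have [sQ|nQ] := pselect {in s, forall x, Q x}; last by exists t0.
  by have [x Qx Px] := step s sQ; exists x.
pose l n := iter n (fun s => rcons s (F s)) [::].
have lQ n : {in l n, forall x, Q x}.
  elim: n => [//|n IH] x; rewrite /= mem_rcons inE => /orP[/eqP->|/IH//].
  by have [] := FP _ IH.
have ul i j : (i < j)%N -> F (l i) \in l j.
  elim: j => [//|j IH]; rewrite ltnS leq_eqVlt /= mem_rcons inE.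
  by move=> /orP[/eqP->|/IH ->]; rewrite ?eqxx ?orbT.
exists (fun n => F (l n)) => [n|i j ij]; first by have [] := FP _ (lQ n).
by have [_] := FP _ (lQ j); apply; exact: ul.
Qed.

Lemma free_ultrafilter :
  exists2 U : set_system nat, UltraFilter U & forall n, U [set k | (n <= k)%N].
Proof.
have [U [UU sU]] := @ultraFilterLemma nat (nbhs \oo) _.
by exists U => // n; apply: sU; exists n.
Qed.

(** In model-theoretic terms, the relation [A (g + h)] is unstable. *)
Definition order_property (G : nmodType) (A : set G) :=
  exists g h : nat -> G,
    (forall i j, (i < j)%N -> A (g i + h j)) /\
    (forall i j, (j < i)%N -> ~ A (g i + h j)).

(** Since the sum is commutative, the two sequences can exchange roles, so it
does not matter on which side of the diagonal the sums belong to [A]. *)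
Lemma order_property_opposite (G : nmodType) (A : set G) (g h : nat -> G) :
  (forall i j, (i < j)%N -> ~ A (g i + h j)) ->
  (forall i j, (j < i)%N -> A (g i + h j)) -> order_property A.
Proof.
by move=> nA hA; exists h, g; split=> i j ij; rewrite addrC; auto.
Qed.

Section Dynamics.
Context {G : nmodType} {X : topologicalType} (a : cont_action G X).
Implicit Types (f : X -> bool) (x y z : X).

(** The translates of [f] are continuous (from right to left) and generate the
topology (from left to right). *)
Definition observable f := forall y (B : set X),
  nbhs y B <-> exists hs : seq G,
    forall z, {in hs, forall h, f (a h z) = f (a h y)} -> B z.

Variables (f : X -> bool) (obs : observable f) (x : X).
Local Notation Y := (set_type (orbit_closure a x)).
Local Notation aY := (orbit_action a x).
Implicit Types (u v : Y).

Let orbit_mem g : orbit_closure a x (a g x).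
Proof.
by move=> B /nbhs_singleton Bg; exists (a g x); split=> //; exists g.
Qed.

Let orb g : Y := SigSub (mem_set (@orbit_mem g)).

Lemma orbit_closure_dense y : orbit_closure a x y ->
  forall hs : seq G, exists g, {in hs, forall h, f (a (h + g) x) = f (a h y)}.
Proof.
move=> yx hs.
have : nbhs y [set z | {in hs, forall h, f (a h z) = f (a h y)}].
  by apply/obs; exists hs.
by move=> /yx[_ [[g _ <-]] /= gP]; exists g => h /gP; rewrite actD.
Qed.

Let nbhs_orbit_closure u (B : set Y) : nbhs u B <-> exists hs : seq G,
  forall v, {in hs, forall h, f (a h (val v)) = f (a h (val u))} -> B v.
Proof.
split=> [[_ [[C oC <-] Cu] CB]|[hs hsB]].
  have /obs[hs hsC] : nbhs (val u) C by apply: open_nbhs_nbhs; split.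
  by exists hs => v /hsC Cv; exact: CB.
have : nbhs (val u) [set z | {in hs, forall h, f (a h z) = f (a h (val u))}].
  by apply/obs; exists hs.
rewrite nbhsE => -[C [oC Cu] CB].
exists (val @^-1` C); split; [by exists C|by []|].
by move=> v /CB; exact: hsB.
Qed.

Let nbhs_value u h : nbhs u [set v : Y | f (a h (val v)) = f (a h (val u))].
Proof. by apply/nbhs_orbit_closure; exists [:: h] => v; apply; rewrite inE. Qed.

Let enveloping_approx (p : Y -> Y) : enveloping_semigroup aY p ->
  forall h (s : seq Y), exists g,
    {in s, forall v, f (a h (a g (val v))) = f (a h (val (p v)))}.
Proof.
move=> Ep h s.
have : nbhs (p : {ptws Y -> Y}) [set q : {ptws Y -> Y} |
    {in s, forall v, f (a h (val (q v))) = f (a h (val (p v)))}].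
  elim: s => [|v s IH]; first by apply: filterS filterT => q _ v.
  have nv : nbhs (p : {ptws Y -> Y}) [set q : {ptws Y -> Y} |
      f (a h (val (q v))) = f (a h (val (p v)))] :=
    @proj_continuous Y (fun=> Y) v p _ (nbhs_value (p v) h).
  apply: filterS (filterI IH nv) => q [qs qv] w; rewrite inE.
  by move=> /orP[/eqP->|/qs].
by move=> /Ep[_ [[g _ <-]] gP]; exists g.
Qed.

(** A discontinuous [p] in the enveloping semigroup separates, for some
translate of [f], a point [u0] from orbit points arbitrarily close to it.
Approximating [p] by elements [g] of the monoid on finitely many points, and
[u0] by such orbit points [k x], alternately, yields [f (g k x)] equal to one
value when [g] is chosen before [k] and to the other value otherwise. *)
Lemma no_order_WAP : ~ order_property [set g | f (a g x)] -> WAP aY.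
Proof.
move=> nop p Ep u B /nbhs_orbit_closure[hs hsB].
change (nbhs u (p @^-1` B)).
suff nh h : nbhs u [set v | f (a h (val (p v))) = f (a h (val (p u)))].
  apply: filterS (_ : nbhs u [set v |
      {in hs, forall h, f (a h (val (p v))) = f (a h (val (p u)))}]).
    by move=> v; exact: hsB.
  elim: hs {hsB} => [|h hs IH]; first by apply: filterS filterT => q _ v.
  apply: filterS (filterI IH (nh h)) => v [vs vh] w; rewrite inE.
  by move=> /orP[/eqP->|/vs].
pose F v := f (a h (val (p v))).
(* It is enough to look at [u0] and at the points of the orbit: if [F] were
   locally constant along the orbit near every point, density would make it
   locally constant. *)
have [[u0 far]|near] := pselect (exists u0 : Y, forall hs : seq G, exists g,
    {in hs, forall k, f (a (k + g) x) = f (a k (val u0))} /\ F (orb g) != F u0);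
    last first.
  have {}near v : exists hs : seq G, forall g,
      {in hs, forall k, f (a (k + g) x) = f (a k (val v))} -> F (orb g) = F v.
    apply: contrapT => nv; apply: near; exists v => ks.
    apply: contrapT => nks; apply: nv; exists ks => g gk.
    by apply/eqP/negP => gv; apply: nks; exists g; split=> //; exact/negP.
  have [us uP] := near u; apply/nbhs_orbit_closure; exists us => v vu.
  have [vs vP] := near v.
  have [g gP] := orbit_closure_dense (set_mem (valP v)) (us ++ vs).
  change (F v = F u).
  rewrite -(vP g) => [|k kv]; last by apply: gP; rewrite mem_cat kv orbT.
  apply: uP => k ku; rewrite gP ?mem_cat ?ku //; exact: vu.
exfalso; apply: nop; set c := F u0 in far.
suff [s sQ sP] : exists2 s : nat -> G * G,
    forall n, F (orb (s n).2) = ~~ c /\ f (a (h + (s n).1) (val u0)) = c &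
    forall i j, (i < j)%N -> f (a (h + ((s j).1 + (s i).2)) x) = ~~ c /\
                             f (a (h + ((s i).1 + (s j).2)) x) = c.
  have c1 i j : (i < j)%N -> f (a (h + (s i).1 + (s j).2) x) = c.
    by move=> /sP[_]; rewrite addrA.
  have c2 i j : (j < i)%N -> f (a (h + (s i).1 + (s j).2) x) = ~~ c.
    by move=> /sP[]; rewrite addrA.
  case: c c1 c2 {far sQ sP} => c1 c2.
    exists (fun i => h + (s i).1), (fun i => (s i).2).
    by split=> i j ij /=; [by rewrite c1|by rewrite c2].
  apply: (@order_property_opposite _ _ (fun i => h + (s i).1)
    (fun i => (s i).2)) => i j ij /=; [by rewrite c1|by rewrite c2].
apply: (pairwise_sequence (T := (G * G)%type)
  (Q := fun r => F (orb r.2) = ~~ c /\ f (a (h + r.1) (val u0)) = c)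
  (P := fun r r' => f (a (h + (r'.1 + r.2)) x) = ~~ c /\
                    f (a (h + (r.1 + r'.2)) x) = c)) => s sQ.
have [g gP] := enveloping_approx Ep h (u0 :: [seq orb r.2 | r <- s]).
have [k [kP kF]] := far [seq h + r.1 | r <- s].
exists (g, k) => /=.
  split; last by rewrite actD; apply: gP; rewrite inE eqxx.
  by move: kF; rewrite /c; case: (F _) (F u0) => [] [].
move=> r rs; have [rF rc] := sQ r rs; split.
  rewrite -rF /F -gP /= ?actD // inE; apply/orP; right.
  by apply/mapP; exists r.
by rewrite addrA (kP (h + r.1)) //; apply/mapP; exists r.
Qed.

Hypothesis X_compact : compact [set: X].

Let ultralimit (U : set_system nat) : UltraFilter U -> forall s : nat -> Y,
  exists v, forall B, nbhs v B -> U [set i | B (s i)].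
Proof.
move=> UU s; pose F := fmap (val \o s) U.
have [y [_ yF]] : [set: X] `&` cluster F !=set0.
  by apply: X_compact; apply: filterT.
have yx : orbit_closure a x y.
  have Us : U [set i | orbit_closure a x (val (s i))].
    by apply: filterE => i; exact: set_mem (valP (s i)).
  by apply: closed_closure => B; exact: yF.
exists (SigSub (mem_set yx)) => B [_ [[C oC <-] Cy] CB].
have [//|UB] := in_ultra_setVsetC [set i | B (s i)] UU.
have Cy' : nbhs y C by apply: open_nbhs_nbhs; split.
have UC : U [set i | ~ C (val (s i))]
  by apply: filterS UB => i nB Ci; apply: nB; exact: CB.
by have [z []] := yF (~` C) C UC Cy'.
Qed.

(** Let [p] be a limit of the [g i] and [v] a limit of the [h j x] along an
ultrafilter.  Then [f (p v)] is true, being the limit in [i] of the values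
[f (g i v)], which are limits in [j] of true values; but [f (p (h j x))] is
false for every [j], so [p] is not continuous at [v]. *)
Lemma WAP_no_order : WAP aY -> ~ order_property [set g | f (a g x)].
Proof.
move=> wap [g [h [gh ngh]]]; have [U UU Uoo] := free_ultrafilter.
have [v|p pP] := @boolp.choice Y Y (fun v w => forall B, nbhs w B ->
    U [set i | B (aY (g i) v)]); first exact: ultralimit.
have Ep : enveloping_semigroup aY p.
  have gp : (fun i => aY (g i) : {ptws Y -> Y}) @ U --> (p : {ptws Y -> Y}).
    apply/cvg_sup => v A [_ [[B oB <-] Bp] BA].
    have UB : U [set i | B (aY (g i) v)].
      by apply: pP; apply: open_nbhs_nbhs; split.
    have UA : U [set i | A (aY (g i))] by apply: filterS UB => i; exact: BA.
    exact: UA.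
  move=> B /gp UB; have {}UB : U [set i | B (aY (g i))] := UB.
  have [i Bi] := @filter_ex _ U _ _ UB.
  by exists (aY (g i)); split=> //; exists (g i).
have [v vP] := ultralimit UU (fun j => orb (h j)).
pose F w := f (a 0 (val (p w))).
have Fv : nbhs v [set w | F w = F v] := wap p Ep v _ (nbhs_value (p v) 0).
have [j Fj] := @filter_ex _ U _ _ (vP _ Fv).
have vE i : f (a (g i) (val v)) = true.
  have [k []] := @filter_ex _ U _ _
    (filterI (vP _ (nbhs_value v (g i))) (Uoo i.+1)).
  by move=> /= <- /gh /=; rewrite actD.
have Ft : F v = true.
  have [i /=] := @filter_ex _ U _ _ (pP v _ (nbhs_value (p v) 0)).
  by rewrite -/(F v) => <-; rewrite act0 /= vE.
have [i []] := @filter_ex _ U _ _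
  (filterI (pP (orb (h j)) _ (nbhs_value (p (orb (h j))) 0)) (Uoo j.+1)).
move=> /= fi /ngh; apply; rewrite /= actD /=.
have {}Fj : F (orb (h j)) = F v := Fj.
by move: fi; rewrite -/(F (orb (h j))) Fj Ft act0 => ->.
Qed.

(** Otherwise, choose alternately [g] in the monoid such that [g x] imitates [y]
on the previous pairs, and a pair [w], [w'] that [y] separates but the previous
[g] do not.  After thinning out by an ultrafilter, the common value of
[f (g i w j x)] and [f (g i w' j x)] for [i < j] is constant; it is then the
sequence [w] or the sequence [w'] that shows the order property. *)
Lemma trace_determined y : orbit_closure a x y ->
  ~ order_property [set g | f (a g x)] ->
  exists hs : seq G, forall w w',
    {in hs, forall h, f (a (h + w) x) = f (a (h + w') x)} ->
    f (a w y) = f (a w' y).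
Proof.
move=> yx nop; apply: contrapT => nhs; apply: nop.
suff [s sQ sP] : exists2 s : nat -> G * (G * G), forall n,
      f (a (s n).2.1 y) /\ ~~ f (a (s n).2.2 y) &
    forall i j, (i < j)%N ->
      [/\ f (a ((s j).1 + (s i).2.1) x), ~~ f (a ((s j).1 + (s i).2.2) x) &
       f (a ((s i).1 + (s j).2.1) x) = f (a ((s i).1 + (s j).2.2) x)].
  have [U UU Uoo] := free_ultrafilter.
  have ulim (u : nat -> bool) : exists c, U [set i | u i = c].
    have [Ut|Uf] := in_ultra_setVsetC [set i | u i = true] UU.
      by exists true.
    by exists false; apply: filterS Uf => i /= /negP/negbTE.
  have [i|c cP] := @boolp.choice nat bool (fun i c =>
    U [set j | f (a ((s i).1 + (s j).2.1) x) = c]); first exact: ulim.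
  have [c0 Uc] := ulim c.
  suff [t tQ tP] : exists2 t : nat -> nat,
      forall i, U [set j | f (a ((s (t i)).1 + (s j).2.1) x) = c0] &
      forall i j, (i < j)%N -> (t i < t j)%N /\
      f (a ((s (t i)).1 + (s (t j)).2.1) x) = c0.
    case: c0 {Uc tQ} tP => tP.
      exists (fun i => (s (t i)).1), (fun i => (s (t i)).2.2).
      split=> i j /tP[tij fij] /=; first by have [_ _ <-] := sP _ _ tij.
      by have [_ /negP] := sP _ _ tij.
    apply: (@order_property_opposite _ _ (fun i => (s (t i)).1)
      (fun i => (s (t i)).2.1)) => i j /tP[tij fij] /=; first by rewrite fij.
    by have [] := sP _ _ tij.
  apply: (pairwise_sequence (T := nat)
    (Q := fun i => U [set j | f (a ((s i).1 + (s j).2.1) x) = c0])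
    (P := fun i j => (i < j)%N /\ f (a ((s i).1 + (s j).2.1) x) = c0)) => t tQ.
  have Ut : U [set j | {in t, forall i, (i < j)%N /\
      f (a ((s i).1 + (s j).2.1) x) = c0}].
    elim: t tQ => [|i t IH] tQ; first by apply: filterE.
    have Ui := tQ i (mem_head _ _).
    have {}IH := IH (fun k kt => tQ k (mem_behead (s := i :: t) kt)).
    apply: filterS (filterI (filterI Ui (Uoo i.+1)) IH) => j [[/= fij ij] tj] k.
    by rewrite inE => /orP[/eqP->|/tj].
  have [j [/= <- jt]] := @filter_ex _ U _ _ (filterI Uc Ut).
  by exists j.
apply: (pairwise_sequence (T := (G * (G * G))%type)
  (Q := fun r => f (a r.2.1 y) /\ ~~ f (a r.2.2 y))
  (P := fun r r' => [/\ f (a (r'.1 + r.2.1) x), ~~ f (a (r'.1 + r.2.2) x) &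
       f (a (r.1 + r'.2.1) x) = f (a (r.1 + r'.2.2) x)])) => s sQ.
have [g gP] := orbit_closure_dense yx
  ([seq r.2.1 | r <- s] ++ [seq r.2.2 | r <- s]).
have [w [w' [ww' fw fw']]] : exists w w', [/\
    {in [seq r.1 | r <- s], forall h, f (a (h + w) x) = f (a (h + w') x)},
    f (a w y) & ~~ f (a w' y)].
  apply: contrapT => nw; apply: nhs; exists [seq r.1 | r <- s] => w w' ww'.
  apply: contrapT => ne; apply: nw.
  case fw: (f (a w y)) ne; case fw': (f (a w' y)) => // _.
    by exists w, w'; rewrite fw fw'.
  by exists w', w; rewrite fw fw'; split=> // h /ww' ->.
exists (g, (w, w')) => //= -[h [v v']] hs /=; have [/= fv fv'] := sQ _ hs.
split; last by apply: ww'; apply/mapP; exists (h, (v, v')).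
  rewrite addrC gP // mem_cat; apply/orP; left.
  by apply/mapP; exists (h, (v, v')).
rewrite addrC gP // mem_cat; apply/orP; right.
by apply/mapP; exists (h, (v, v')).
Qed.

(** A point is coded by the translates that determine its trace together with
the list of those value patterns for which [f] is true. *)
Lemma no_order_countable (idx : G -> nat) : injective idx ->
  (forall y z, (forall h, f (a h y) = f (a h z)) -> y = z) ->
  ~ order_property [set g | f (a g x)] -> countable (orbit_closure a x).
Proof.
move=> idx_inj sep nop.
pose trace (hs : seq G) w := [seq f (a (h + w) x) | h <- hs].
pose codes y (c : seq G * seq (seq bool)) :=
  forall w, f (a w y) = (trace c.1 w \in c.2).
have [y|code codeP] := @boolp.choice X (seq G * seq (seq bool))%type
  (fun y c => orbit_closure a x y -> codes y c).
  have [yx|nyx] := pselect (orbit_closure a x y); last by exists ([::], [::]).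
  have [hs hsP] := trace_determined yx nop.
  exists (hs, [seq tval t | t : (size hs).-tuple bool <-
     enum {: (size hs).-tuple bool} &
     `[< exists2 w, trace hs w = t & f (a w y) >]]) => _ w /=.
  apply/idP/mapP => [fw|[t]].
    have st : size (trace hs w) == size hs by rewrite size_map.
    exists (Tuple st) => //; rewrite mem_filter mem_enum inE andbT.
    by apply/asboolP; exists w.
  rewrite mem_filter => /andP[/asboolP[w' <- fw'] _] ww'.
  rewrite (hsP w w') // => h hhs.
  by move/eq_in_map: ww' => ->.
apply/countable_injP.
exists (fun y => choice.pickle ([seq idx h | h <- (code y).1], (code y).2)).
move=> y z /set_mem yx /set_mem zx /(pcan_inj choice.pickleK)[e1 e2].
apply: sep => h; rewrite (codeP y yx) (codeP z zx) e2.
by have -> := inj_map idx_inj e1.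
Qed.

End Dynamics.

(** * Labels and bit sequences as observed systems *)

Section Instances.

(** An ultrafilter converges as soon as every translate of [f] has the same
value at the limit as along the ultrafilter, and the value along an ultrafilter
always exists; only a point realising these values is needed. *)
Lemma observable_compact (G : nmodType) (X : topologicalType)
    (a : cont_action G X) (f : X -> bool) : observable a f ->
  (forall F : set_system X, UltraFilter F ->
     exists y, forall h, F [set z | f (a h z) = f (a h y)]) ->
  compact [set: X].
Proof.
move=> obs lim; rewrite compact_ultra => F UF _.
have [y Fy] := lim F UF; exists y; split=> // B /obs[hs hsB].
suff : F [set z | {in hs, forall h, f (a h z) = f (a h y)}].
  exact: filterS.
move=> {hsB}; elim: hs => [|h hs IH].
  by apply: filterS filterT => z _ h.
apply: filterS (filterI (Fy h) IH) => z [zh zhs] k.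
by rewrite inE => /orP[/eqP->|/zhs].
Qed.

Lemma ultra_decides (T : Type) (F : set_system T) (A : set T) :
  UltraFilter F -> F [set z | `[<A z>] = `[<F A>]].
Proof.
move=> UF; have [FA|FA] := in_ultra_setVsetC A UF.
  by apply: filterS (FA) => z Az; rewrite /= !asboolT.
have nFA : ~ F A.
  by move=> FA'; have [? []] := @filter_ex _ F _ _ (filterI FA FA').
by apply: filterS (FA) => z nAz; rewrite /= !asboolF.
Qed.

Lemma shift_observable : observable shift_action (fun x : bitseqZ => x 0).
Proof.
move=> y B; split=> [|[hs]]; last first.
  elim: hs B => [|h hs IH] B hB.
    by apply: filterS filterT => z _; apply: hB => h.
  have nh : nbhs (y : bitseqZ) [set z : bitseqZ | z (0 + h) = y (0 + h)].
    apply: (@proj_continuous int (fun=> bool) (0 + h) y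
      [set c | c = y (0 + h)]).
    exact: discrete_set1.
  have ns := IH [set z : bitseqZ | {in hs, forall h, z (0 + h) = y (0 + h)}]
    (fun _ => id).
  apply: filterS (filterI nh ns) => z [zh zs]; apply: hB => k.
  by rewrite inE => /orP[/eqP->|/zs].
(* The sets containing such a basic set form a filter; it converges to [y]
   coordinatewise, hence is finer than the neighbourhood filter. *)
pose F : set_system bitseqZ := fun B => exists hs : seq int,
    forall z, {in hs, forall h, shift_action h z 0 = shift_action h y 0} -> B z.
have FF : Filter F.
  split.
  - by exists [::].
  - move=> P Q [hs hP] [ks kQ]; exists (hs ++ ks) => z zP.
    by split; [apply: hP|apply: kQ] => h hh; apply: zP; rewrite mem_cat hh ?orbT.
  - by move=> P Q PQ [hs hP]; exists hs => z /hP /PQ.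
suff Fy : F --> (y : bitseqZ) by apply: Fy.
apply/cvg_sup => t A [_ [[C oC <-] Cy] CA].
exists [:: t] => z zt; apply: CA.
have {}zt : z t = y t.
  by have := zt t (mem_head _ _); rewrite /= /Defs.shift add0r.
by rewrite /= zt.
Qed.

Lemma bitseqZ_compact : compact [set: bitseqZ].
Proof.
apply: observable_compact shift_observable _ => F UF.
exists (fun t => `[<F [set z : bitseqZ | z t]>]) => h.
have := @ultra_decides _ F [set z : bitseqZ | z (0 + h)] UF.
by apply: filterS => z /=; rewrite asboolb.
Qed.

End Instances.

Section LabelSpace.
Variable R : realType.

Lemma Nvec_sum (I : Type) (s : seq I) (P : pred I) (F : I -> Nvec) l :
  (\sum_(i <- s | P i) F i : Nvec) l = (\sum_(i <- s | P i) F i l)%N.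
Proof.
elim/big_rec2: _ => [|i m n _ <-]; last by rewrite NvecD.
by rewrite mset0E.
Qed.

Lemma Nbox_finite N : exists hs : seq Nvec, forall m, Nbox N m -> m \in hs.
Proof.
exists [seq (\sum_(i < N) msetn (g i) (exist _ i.+1 (ltn0Sn i)) : Nvec) |
  g : {ffun 'I_N -> 'I_N.+1} <- enum {: {ffun 'I_N -> 'I_N.+1}}] => m mN.
apply/mapP; exists [ffun i : 'I_N => inord (m (exist _ i.+1 (ltn0Sn i)))].
  by rewrite mem_enum.
apply/msetP => l; rewrite Nvec_sum; have [ml sl] := mN l.
have [lN|Nl] := leqP (val l) N; last first.
  rewrite big1 => [|i _].
    have [/sl lN|/fsfun_dflt//] := boolP (l \in finsupp m).
    by have := leq_trans Nl lN; rewrite ltnn.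
  rewrite msetnE; case: eqP => // il.
  by move: Nl; rewrite il ltnS leqNgt ltn_ord.
have l0 : (0 < val l)%N := valP l.
have lN' : ((val l).-1 < N)%N by lia.
have lE : l = exist _ (Ordinal lN').+1 (ltn0Sn _).
  by apply: val_inj; rewrite /= prednK.
rewrite (bigD1 (Ordinal lN')) //= big1 => [|i ne].
  rewrite addn0 -lE msetnxx ffunE -lE inordK //; exact: leqW.
rewrite msetnE; case: eqP => // il; case/eqP: ne; apply: val_inj => /=.
by rewrite il.
Qed.

Lemma label_observable :
  observable (label_action R) (fun M : LAB R => `[<label_set M 0>]).
Proof.
move=> y B.
split=> [/nbhs_ballP[e e0 eB]|[hs hsB]].
  have /label_dist_lt[N _ Ne] : label_dist R y y < e by rewrite label_distxx.
  have [hs hsN] := Nbox_finite N; exists hs => z zP; apply: eB.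
  rewrite ballEmdist /=; apply/label_dist_lt; exists N => //.
  have zy m : Nbox N m -> label_set z m <-> label_set y m.
    by move=> /hsN /zP e1; have := asbool_eq_equiv e1; rewrite /= add0r.
  by apply/seteqP; split=> m [mz mN]; split=> //; apply/zy.
have [N hsN] : exists N, {in hs, forall h, Nbox N h}.
  elim: hs {hsB} => [|h hs [N IH]]; first by exists 0%N.
  have [K hK] := Nbox_exists h; exists (N + K)%N => k.
  rewrite inE => /orP[/eqP->|/IH]; last exact/Nbox_mono/leq_addr.
  exact: Nbox_mono (leq_addl _ _) _ hK.
apply/nbhs_ballP; exists (2^-1 ^+ N); first exact: exprn_gt0.
move=> z; rewrite ballEmdist /= => /label_dist_lt[n a].
rewrite ltr_iXn2l ?invr_gt0 ?invf_lt1 ?ltr1n // => /ltnW Nn.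
have {}a := label_agree_mono Nn a.
apply: hsB => h hh /=; rewrite !add0r; apply/asbool_equiv_eq.
have hN := hsN h hh; split=> hz.
  by have : ((z : label) `&` Nbox N) h by []; rewrite -a => -[].
by have : ((y : label) `&` Nbox N) h by []; rewrite a => -[].
Qed.

Lemma LAB_compact : compact [set: LAB R].
Proof.
apply: observable_compact label_observable _ => F UF.
have dn m1 m : (m1 `<=` m)%mset -> F [set M | label_set M m] ->
    F [set M | label_set M m1].
  by move=> m1m; apply: filterS => M; exact: label_down.
exists (Label dn) => h /=.
by have := @ultra_decides _ F [set M | label_set M (0 + h)] UF.
Qed.

End LabelSpace.

Lemma label_WAP_order (R : realType) (M : label) :
  label_WAP R M <-> ~ order_property M.
Proof.
have e : [set r | `[<label_set (label_action R r M) 0>]] = M :> set _.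
  by apply/seteqP; split=> r /=; rewrite add0r => /asboolP.
rewrite -e; split.
  exact: WAP_no_order (@label_observable R) _ (@LAB_compact R).
exact: (@no_order_WAP _ _ _ _ (@label_observable R) M).
Qed.

Lemma Theta_countable (R : realType) (M : label) :
  ~ order_property M -> countable (Theta R M).
Proof.
have e : [set r | `[<label_set (label_action R r M) 0>]] = M :> set _.
  by apply/seteqP; split=> r /=; rewrite add0r => /asboolP.
rewrite -e; apply: (no_order_countable (@label_observable R)
  (idx := fun m : Nvec => choice.pickle (enum_mset m))).
  move=> m m' /(pcan_inj choice.pickleK) mm'.
  by rewrite -(seq_mset_id m) mm' seq_mset_id.
move=> y z yz; apply/label_eqP/seteqP.
by split=> m; have := asbool_eq_equiv (yz m); rewrite /= add0r => -[].
Qed.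

Lemma char_seq_WAP_order (A : set int) :
  WAP (orbit_action shift_action (char_seq A)) <-> ~ order_property A.
Proof.
have e : [set n | shift_action n (char_seq A) 0] = A.
  by apply/seteqP; split=> n /=; rewrite /Defs.shift /char_seq add0r inE.
rewrite -[in order_property _]e; split.
  exact: (@WAP_no_order _ _ _ _ shift_observable (char_seq A) bitseqZ_compact).
exact: (@no_order_WAP _ _ _ _ shift_observable (char_seq A)).
Qed.

Lemma char_seq_orbit_countable (A : set int) :
  ~ order_property A -> countable (orbit_closure shift_action (char_seq A)).
Proof.
have e : [set n | shift_action n (char_seq A) 0] = A.
  by apply/seteqP; split=> n /=; rewrite /Defs.shift /char_seq add0r inE.
rewrite -[in order_property _]e; apply: (no_order_countable shift_observable
  (idx := @choice.pickle int)); first exact: (pcan_inj choice.pickleK).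
by move=> y z yz; apply/funext => t; have := yz t; rewrite /= /Defs.shift add0r.
Qed.

(** * Bounded labels without the order property *)

Lemma label_le (M : label) (m m' : Nvec) :
  (forall l, (m l <= m' l)%N) -> label_set M m' -> label_set M m.
Proof. by move=> mm'; apply: label_down; apply/msubsetP. Qed.

(** A strictly increasing chain supported in a fixed finite set has total mass
growing by at least one at each step; with a coordinatewise bound, such a chain
cannot be infinite. *)
Lemma mproper_chain_unbounded (u : nat -> Nvec) (F : {fset posnat}) :
  (forall i, (u i `<` u i.+1)%mset) ->
  (forall i, {subset finsupp (u i) <= F}) ->
  forall i, (i <= \sum_(l <- F) u i l)%N.
Proof.
move=> inc uF; elim=> [//|i IH]; apply: leq_ltn_trans IH _.
have := inc i; rewrite mproperE => /andP[/msubsetP le /msubsetP nle].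
rewrite ltnNge; apply/negP => ge; apply: nle => l.
have [lF|lF] := boolP (l \in F); last first.
  by rewrite fsfun_dflt //; apply: contra lF; exact: uF.
move: ge; rewrite (big_fsetD1 l) //= [leqRHS](big_fsetD1 l) //= => ge.
rewrite -(leq_add2r (\sum_(k <- (F `\ l)%fset) u i.+1 k)).
by apply: leq_trans ge _; rewrite leq_add2l; exact: leq_sum.
Qed.

(** For a coordinate [l] that some term of the chain [u] meets, let [e] be the
largest multiplicity of [l] that fits into [M] beside the other coordinates of
every term.  Adding [e] times [l] stays in [M] for the terms that vanish at [l],
and leaves [M] for the late terms, where [l] then has multiplicity above [e].
Boundedness provides [e], and also infinitely many coordinates. *)
Lemma bounded_stable_finite_type (M : label) :
  label_bounded M -> ~ order_property M -> label_finite_type M.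
Proof.
move=> bd nop [u uP]; apply: nop.
have uM n : label_set M (u n) by case: (uP n).
have inc n : (u n `<` u n.+1)%mset by case: (uP n).
have mono n n' : (n <= n')%N -> forall l, (u n l <= u n' l)%N.
  move=> /subnK <- l; elim: (n' - n)%N => [//|d IH].
  by apply: leq_trans IH _; move: l; apply/msubsetP/mproper_sub.
have fresh n : exists l n', u n l = 0%N /\ (0 < u n' l)%N.
  apply: contrapT => nl.
  have sub i : {subset finsupp (u i) <= finsupp (u n)}.
    move=> l; rewrite !mem_finsupp -!lt0n => ui.
    by rewrite lt0n; apply/eqP => un; apply: nl; exists l, i.
  have [K KP] : exists K, forall i, (\sum_(l <- finsupp (u n)) u i l <= K)%N.
    elim: (enum_fset (finsupp (u n))) => [|l s [K KP]].
      by exists 0%N => i; rewrite big_nil.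
    have [B BP] := bd l; exists (B + K)%N => i; rewrite big_cons.
    by rewrite leq_add ?BP.
  have := mproper_chain_unbounded inc sub K.+1; have := KP K.+1; lia.
(* [room l c]: multiplicity [c] at [l] fits beside every term of the chain. *)
pose room (l : posnat) c := forall m (v : Nvec),
  (forall k, k != l -> (v k <= u m k)%N) -> (v l <= c)%N -> label_set M v.
have fill l : (exists n, (0 < u n l)%N) -> exists e, room l e /\
    exists m, forall n, (m <= n)%N -> ~ label_set M (u n + msetn e l).
  move=> [n0 n0l]; have [K KP] := bd l.
  have ex : exists c, `[<room l c>].
    exists 0%N; apply/asboolP => m v vm vl; apply: label_le (uM m) => k.
    by have [->|/vm//] := eqVneq k l; apply: leq_trans vl _.
  have ub c : `[<room l c>] -> (c <= K)%N.
    move=> /asboolP rc; rewrite -(msetnxx c l); apply: KP.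
    by apply: (rc 0%N) => [k kl|]; rewrite msetnE ?(negbTE kl) ?eqxx.
  case: (ex_maxnP ex ub) => e /asboolP re emax; exists e; split=> //.
  have : ~ room l e.+1 by move=> /asboolP /emax; rewrite ltnn.
  move=> nr; apply: contrapT => nm; apply: nr => m v vm vl.
  apply: contrapT => nv; apply: nm; exists (maxn m n0) => n; rewrite geq_max.
  move=> /andP[mn n0n] Mn; apply: nv; apply: label_le Mn => k.
  rewrite NvecD msetnE; have [->|kl] := eqVneq k l.
    by apply: leq_trans vl _; have := mono _ _ n0n l; lia.
  by rewrite addn0; apply: leq_trans (vm _ kl) (mono _ _ mn k).
suff [s sQ sP] : exists2 s : nat -> nat * (posnat * nat),
    forall i, room (s i).2.1 (s i).2.2 /\
      exists m, forall n, (m <= n)%N ->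
        ~ label_set M (u n + msetn (s i).2.2 (s i).2.1) &
    forall i j, (i < j)%N -> u (s i).1 (s j).2.1 = 0%N /\
      ~ label_set M (u (s j).1 + msetn (s i).2.2 (s i).2.1).
  exists (fun i => u (s i).1), (fun j => msetn (s j).2.2 (s j).2.1).
  split=> i j ij; last by have [] := sP _ _ ij.
  have [rj _] := sQ j; have [u0 _] := sP _ _ ij.
  apply: (rj (s i).1) => [k kl|]; rewrite NvecD msetnE ?(negbTE kl) ?addn0 //.
  by rewrite eqxx u0.
apply: (pairwise_sequence (T := (nat * (posnat * nat))%type)
  (Q := fun r => room r.2.1 r.2.2 /\ exists m, forall n, (m <= n)%N ->
        ~ label_set M (u n + msetn r.2.2 r.2.1))
  (P := fun r r' => u r.1 r'.2.1 = 0%N /\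
      ~ label_set M (u r'.1 + msetn r.2.2 r.2.1))) => s sQ.
have [n nP] : exists n, {in s, forall r, (r.1 <= n)%N /\
    ~ label_set M (u n + msetn r.2.2 r.2.1)}.
  suff [n nP] : exists n, forall n', (n <= n')%N -> {in s, forall r,
      (r.1 <= n')%N /\ ~ label_set M (u n' + msetn r.2.2 r.2.1)}.
    by exists n; exact: nP.
  elim: s sQ => [|r s IH] sQ; first by exists 0%N.
  have [n nP] := IH (fun k kt => sQ k (mem_behead (s := r :: s) kt)).
  have [_ [m mP]] := sQ r (mem_head _ _).
  exists (maxn r.1 (maxn m n)) => n'; rewrite !geq_max => /and3P[rn mn nn] k.
  by rewrite inE => /orP[/eqP->|/(nP _ nn)//]; split=> //; exact: mP.
have [l [n' [ul un']]] := fresh n.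
have [e [re nre]] := fill l (ex_intro _ n' un').
exists (n, (l, e)) => //= r rs; have [rn nM] := nP r rs; split=> //.
by have := mono _ _ rn l; rewrite ul leqn0 => /eqP.
Qed.

(** * Expansions as polynomials *)

Section Digits.
(** [lev i] is the index of the class of the position of [b ^ i]. *)
Variable lev : nat -> posnat.
Implicit Types (p q : {poly int}) (M : label).

(** The length vector of the expansion whose digits are the coefficients. *)
Definition lenvec p : Nvec :=
  \sum_(0 <= i < size p | p`_i != 0) msetn 1 (lev i).

Lemma lenvecE p N : (size p <= N)%N ->
  lenvec p = \sum_(0 <= i < N | p`_i != 0) msetn 1 (lev i).
Proof.
move=> pN; rewrite [RHS](@big_cat_nat _ _ _ (size p)) //=.
rewrite -/(lenvec p) [X in _ + X]big1_seq ?addr0 // => i /andP[pi].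
by rewrite mem_index_iota => /andP[/leq_sizeP pi0]; rewrite pi0 ?eqxx in pi.
Qed.

Lemma lenvec_le p q : (forall i, q`_i != 0 -> p`_i != 0) ->
  forall l, (lenvec q l <= lenvec p l)%N.
Proof.
move=> qp l; pose N := maxn (size p) (size q).
rewrite (@lenvecE p N) ?leq_maxl // (@lenvecE q N) ?leq_maxr //.
rewrite !Nvec_sum big_mkcond [leqRHS]big_mkcond leq_sum // => i _.
by case: ifP => // /qp ->.
Qed.

Lemma lenvecD p q : (forall i, p`_i = 0 \/ q`_i = 0) ->
  lenvec (p + q) = lenvec p + lenvec q.
Proof.
move=> pq; pose N := maxn (size p) (size q).
rewrite (@lenvecE p N) ?leq_maxl // (@lenvecE q N) ?leq_maxr //.
rewrite (@lenvecE _ N) ?size_polyD //.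
rewrite big_mkcond [in RHS]big_mkcond [X in _ = _ + X]big_mkcond -big_split /=.
apply: eq_bigr => i _; rewrite coefD.
by case: (pq i) => ->; rewrite eqxx /= !(add0r, addr0).
Qed.

Lemma lenvecZXn c n : c != 0 -> lenvec (c *: 'X^n) = msetn 1 (lev n).
Proof.
move=> c0; have sz : (size (c *: 'X^n) <= n.+1)%N.
  by rewrite (leq_trans (size_scale_leq _ _)) ?size_polyXn.
rewrite (lenvecE sz) big_mkcond big_nat_recr //= big1_seq ?add0r.
  by rewrite coefZ coefXn eqxx mulr1 c0.
move=> i; rewrite mem_index_iota => /andP[_ ni].
by rewrite coefZ coefXn ltn_eqF // mulr0 eqxx.
Qed.

Lemma lenvecXn n : lenvec 'X^n = msetn 1 (lev n).
Proof. by rewrite -[X in lenvec X]scale1r lenvecZXn. Qed.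

Lemma lenvec0 : lenvec 0 = 0.
Proof. by rewrite /lenvec size_poly0 big_geq. Qed.

Hypothesis lev_inf : forall l N, exists2 i, (N <= i)%N & lev i = l.

Definition signed_digit (c : int) := `|c| <= 1.
Definition unsigned_digit (c : int) := c = 0 \/ c = 1.

Definition digits01 p := forall i, unsigned_digit p`_i.

Lemma digits01D p q : (forall i, p`_i = 0 \/ q`_i = 0) ->
  digits01 p -> digits01 q -> digits01 (p + q).
Proof.
move=> pq p01 q01 i; rewrite coefD.
by case: (pq i) => ->; rewrite ?add0r ?addr0.
Qed.

Lemma digits01Xn n : digits01 'X^n.
Proof. by move=> i; rewrite coefXn; case: eqP; [right|left]. Qed.

(** The classes of positions are infinite, so any vector can be realised as far
out as desired. *)
Lemma lenvec_realize (r : Nvec) N : exists p,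
  [/\ digits01 p, forall i, (i < N)%N -> p`_i = 0 & lenvec p = r].
Proof.
rewrite -(seq_mset_id r); elim: (enum_mset r) => [|l s [p [p01 pN pr]]].
  exists 0; split=> [i|i _|]; rewrite ?coef0 ?lenvec0; [by left|by []|].
  by apply/msetP => l; rewrite mset_seqE mset0E.
have [n nN nl] := lev_inf l (maxn N (size p)).
move: nN; rewrite geq_max => /andP[Nn pn].
have dis i : ('X^n : {poly int})`_i = 0 \/ p`_i = 0.
  rewrite coefXn; have [->|_] := eqVneq i n; last by left.
  by right; rewrite nth_default.
exists ('X^n + p); split=> [|i iN|].
- by apply: digits01D => //; exact: digits01Xn.
- by rewrite coefD pN // coefXn ltn_eqF ?addr0 // (leq_trans iN).
- by rewrite lenvecD // lenvecXn nl pr mset_cons.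
Qed.

Definition small (k : int) p := forall i, `|p`_i| <= k.

Variable b : nat.
Hypothesis b_ge5 : (5 <= b)%N.
Local Notation "p .[b]" := (horner p b%:Z) (at level 2, format "p .[b]").

(** The constant coefficient is a multiple of [b] of absolute value at most 4,
hence zero; then divide by the variable. *)
Lemma small_root p : small 4 p -> p.[b] = 0 -> p = 0.
Proof.
elim/poly_ind: p => [//|p c IH] sp.
rewrite hornerMXaddC => e.
have c4 : `|c| <= 4 by have := sp 0%N; rewrite coefD coefMX coefC add0r.
have p0 : p.[b] = 0 by move: e c4; case: (p.[b]) => n; nia.
rewrite IH // ?mul0r ?add0r; last first.
  by move=> i; have := sp i.+1; rewrite coefD coefMX coefC addr0.
by move: e; rewrite p0 mul0r add0r => ->.
Qed.

(** Polynomial arithmetic is arithmetic of expansions without carries; this is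
where the size of [b] enters. *)
Lemma horner_inj_small p q : small 2 p -> small 2 q -> p.[b] = q.[b] -> p = q.
Proof.
move=> sp sq e; apply/eqP; rewrite -subr_eq0; apply/eqP.
apply: small_root; last by rewrite hornerD hornerN e subrr.
move=> i; rewrite coefB; apply: le_trans (ler_normB _ _) _.
exact: lerD (sp i) (sq i).
Qed.

(** Each nonzero digit adds a unit to the length vector of the truncations, so
infinitely many of them would give an increasing sequence. *)
Lemma chain_finite M (e : nat -> int) : label_finite_type M ->
  (forall N, label_set M (lenvec (\poly_(n < N) e n))) ->
  exists N, forall n, (N <= n)%N -> e n = 0.
Proof.
move=> ft eM; apply: contrapT => ne; apply: ft.
have [N|f fP] := @boolp.choice nat nat (fun N n => (N <= n)%N /\ e n != 0).
  apply: contrapT => nN; apply: ne; exists N => n Nn; apply/eqP/negP => en.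
  by apply: nN; exists n; split=> //; apply/negP.
pose k i := iter i (fun N => (f N).+1) 0%N.
exists (fun i => lenvec (\poly_(n < k i) e n)) => i; split=> //.
rewrite /= -/(k i); set N := k i; have [Nn en] := fP N; set n := f N in Nn en *.
have -> : \poly_(m < n.+1) e m = \poly_(m < n) e m + e n *: 'X^n.
  by rewrite !poly_def big_ord_recr.
have dis m : (\poly_(m < n) e m)`_m = 0 \/ (e n *: 'X^n)`_m = 0.
  rewrite coef_poly coefZ coefXn; case: ltnP => mn; last by left.
  by right; rewrite ltn_eqF // mulr0.
rewrite lenvecD // lenvecZXn //.
have le l : (lenvec (\poly_(m < N) e m) l <= lenvec (\poly_(m < n) e m) l)%N.
  apply: lenvec_le => m; rewrite !coef_poly; case: ltnP => // mN.
  by rewrite (leq_trans mN).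
rewrite mproperE; apply/andP; split.
  by apply/msubsetP => l; rewrite NvecD (leq_trans (le l)) // leq_addr.
apply/negP => /msubsetP /(_ (lev n)); rewrite NvecD msetnxx.
have := le (lev n); lia.
Qed.

Section Alphabet.
(** The digits allowed in expansions: -1, 0, 1 for [A[M]], and 0, 1 for
[A_+[M]].  Both cases have the same proof. *)
Variable E : int -> Prop.
Hypotheses (E0 : E 0) (E1 : E 1) (E_small : forall c, E c -> `|c| <= 1).

Definition digit_polys M : set {poly int} :=
  [set p : {poly int} | (forall i, E p`_i) /\ label_set M (lenvec p)].

Definition digit_ints M : set int :=
  (fun p : {poly int} => p.[b]) @` digit_polys M.

Lemma digit_polys_small M p : digit_polys M p -> small 1 p.
Proof. by move=> [pE _] i; exact: E_small. Qed.

Lemma digits01_small p : digits01 p -> small 1 p.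
Proof. by move=> /[swap] i /(_ i)[] ->. Qed.

Lemma small12 p : small 1 p -> small 2 p.
Proof. by move=> sp i; apply: le_trans (sp i) _. Qed.

Lemma digit_ints_horner M p :
  small 2 p -> digit_ints M p.[b] -> digit_polys M p.
Proof.
move=> sp [q Mq /horner_inj_small qp].
by rewrite -qp //; apply/small12/digit_polys_small/Mq.
Qed.

Lemma digits01_E p i : digits01 p -> E p`_i.
Proof. by move=> /(_ i)[] ->. Qed.

(** Realise the vectors by expansions on disjoint sets of positions.  Only a
subsequence is realised, so that [r.1] records the original index. *)
Lemma order_label_ints M : order_property M -> order_property (digit_ints M).
Proof.
move=> [g [h [gh ngh]]].
pose T := (nat * ({poly int} * {poly int}))%type.
pose Q (r : T) := [/\ digits01 r.2.1, digits01 r.2.2,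
  lenvec r.2.1 = g r.1 & lenvec r.2.2 = h r.1].
pose P (r r' : T) := (r.1 < r'.1)%N /\
  forall i, (i < maxn (size r.2.1) (size r.2.2))%N ->
     r'.2.1`_i = 0 /\ r'.2.2`_i = 0.
have [s|s sQ sP] := @pairwise_sequence T Q P.
  move=> sQ; pose n := (\max_(r <- s) r.1).+1.
  pose N := (\max_(r <- s) maxn (size r.2.1) (size r.2.2))%N.
  have [p [p01 pN pr]] := lenvec_realize (g n) N.
  have [q [q01 qN qr]] := lenvec_realize (h n) N.
  exists (n, (p, q)) => // r rs; split=> /=.
    by rewrite ltnS (@leq_bigmax_seq _ s xpredT (fun r : T => r.1) r).
  move=> i ir; have iN : (i < N)%N.
    apply: leq_trans ir _.
    exact: (@leq_bigmax_seq _ s xpredT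
      (fun r : T => maxn (size r.2.1) (size r.2.2)) r).
  by rewrite pN ?qN.
exists (fun i => (s i).2.1.[b]), (fun j => (s j).2.2.[b]).
have dis i j : i != j -> forall n, (s i).2.1`_n = 0 \/ (s j).2.2`_n = 0.
  rewrite neq_ltn => /orP[/sP[_ ij]|/sP[_ ji]] n.
    have [/ij[_ ->]|ni] := ltnP n (maxn (size (s i).2.1) (size (s i).2.2)).
      by right.
    by left; rewrite nth_default // (leq_trans _ ni) // leq_maxl.
  have [/ji[-> _]|ni] := ltnP n (maxn (size (s j).2.1) (size (s j).2.2)).
    by left.
  by right; rewrite nth_default // (leq_trans _ ni) // leq_maxr.
have d01 i j : i != j -> digits01 ((s i).2.1 + (s j).2.2).
  move=> ij; have [? _ _ _] := sQ i; have [_ ? _ _] := sQ j.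
  by apply: digits01D => //; exact: dis.
have len i j : i != j ->
    lenvec ((s i).2.1 + (s j).2.2) = g (s i).1 + h (s j).1.
  move=> ij; have [_ _ <- _] := sQ i; have [_ _ _ <-] := sQ j.
  by rewrite lenvecD //; exact: dis.
split=> i j ij; rewrite -hornerD.
  exists ((s i).2.1 + (s j).2.2) => //; split.
    by move=> n; apply/digits01_E/d01; rewrite ltn_eqF.
  by rewrite len ?ltn_eqF //; apply: gh; have [] := sP _ _ ij.
move=> /digit_ints_horner[].
  by apply/small12/digits01_small/d01; rewrite gtn_eqF.
move=> _; rewrite len ?gtn_eqF //; apply: ngh; by have [] := sP _ _ ij.
Qed.

(** With [d] an increasing enumeration of positions in the unbounded class,
compare the sums of the first powers [b ^ d m] with the single powers
[b ^ d j]: fresh powers give another expansion with digits 0 and 1, and a power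
that already occurs gives the digit 2. *)
Lemma unbounded_order M : ~ label_bounded M -> order_property (digit_ints M).
Proof.
rewrite /label_bounded => /existsNP[l /forallNP nb].
have lM n : label_set M (msetn n l).
  have /existsNP[m /not_implyP[Mm /negP]] := nb n; rewrite -ltnNge => nm.
  by apply: label_le Mm => k; rewrite msetnE; case: eqP => // ->; exact: ltnW.
have [s|d dl dlt] := @pairwise_sequence nat (fun n => lev n = l)
  (fun k n => (k < n)%N).
  move=> _; have [n sn nl] := lev_inf l (\max_(k <- s) k).+1.
  exists n => // k ks; apply: leq_trans sn.
  by rewrite ltnS (@leq_bigmax_seq _ s xpredT id k).
pose S k : {poly int} := \sum_(m < k) 'X^(d m).
have SS k : S k.+1 = S k + 'X^(d k) by rewrite /S big_ord_recr.
have S1 k n : (k <= n)%N -> (S k)`_(d n) = 0.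
  move=> kn; rewrite coef_sum big1 // => m _; rewrite coefXn gtn_eqF //.
  by apply: dlt; apply: leq_trans kn.
have dis k n : (k <= n)%N ->
    forall i, (S k)`_i = 0 \/ ('X^(d n) : {poly int})`_i = 0.
  by move=> kn i; rewrite coefXn; case: eqP => [->|_]; [left; exact: S1|right].
have S01 k : digits01 (S k).
  elim: k => [i|k IH]; first by left; rewrite /S big_ord0 coef0.
  by rewrite SS; apply: digits01D (digits01Xn _) => //; exact: dis.
have lS k : lenvec (S k) = msetn k l.
  elim: k => [|k IH]; first by rewrite /S big_ord0 lenvec0 msetn0.
  rewrite SS lenvecD ?lenvecXn ?dl ?IH; last exact: dis.
  by apply/msetP => m; rewrite NvecD !msetnE; case: eqP => // _; rewrite addn1.
exists (fun i => (S i.+1).[b]), (fun j => ('X^(d j)).[b]).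
split=> i j ij; rewrite -hornerD.
  exists (S i.+1 + 'X^(d j)) => //; split.
    move=> n; apply: digits01_E; apply: digits01D (digits01Xn _) => //.
    exact: dis.
  rewrite lenvecD ?lS ?lenvecXn ?dl; last exact: dis.
  suff -> : (msetn i.+1 l + msetn 1 l : Nvec) = msetn i.+2 l by [].
  by apply/msetP => m; rewrite NvecD !msetnE; case: eqP => // _; rewrite addn1.
have Sj : (S i.+1)`_(d j) = 1.
  have : (j < i.+1)%N by rewrite ltnS ltnW.
  elim: (i.+1) => [//|k IH]; rewrite ltnS leq_eqVlt => /orP[/eqP->|ji].
    by rewrite SS coefD S1 // coefXn eqxx add0r.
  rewrite SS coefD IH // coefXn ltn_eqF ?addr0 //; exact: dlt.
move=> /digit_ints_horner[].
  move=> n; rewrite coefD; apply: le_trans (ler_normD _ _) _.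
  exact: lerD (digits01_small (S01 _) n) (digits01_small (digits01Xn _) n).
by move=> /(_ (d j)); rewrite coefD Sj coefXn eqxx => /E_small.
Qed.

(** Finitely many values: one of them is taken on a set of the ultrafilter. *)
Lemma ultra_int_limit (U : set_system nat) (f : nat -> int) (B : nat) :
  UltraFilter U -> (forall k, `|f k| <= B%:Z) -> exists c, U [set k | f k = c].
Proof.
move=> UU fB; pose s : seq int := [seq i%:Z - B%:Z | i <- iota 0 (2 * B).+1].
have fs : U [set k | f k \in s].
  apply: filterE => k; apply/mapP; have := fB k.
  by exists (absz (f k + B%:Z)); rewrite ?mem_iota; lia.
elim: s fs => [|c s IH] fs; first by have [] := @filter_ex _ U _ _ fs.
have [|nc] := in_ultra_setVsetC [set k | f k = c] UU; first by exists c.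
apply: IH; apply: filterS (filterI fs nc) => k [/= + fc].
by rewrite inE => /orP[/eqP|].
Qed.

(** [Q] and [W] are the limits of the coefficients of [p] and [w].  Truncations
of [W] are dominated by some [w k] and those of [Q + W] by some [p i + w j], so
by finite type both limits vanish beyond some [N0].  The remainders [p'] and
[w'] of a subsequence along which the agreement with the limits improves fast
enough have disjoint supports, so the length vector of [p i + w j] splits into a
constant, a part depending on [i] and a part depending on [j]. *)
Lemma order_digit_polys M (p w : nat -> {poly int}) :
  label_finite_type M -> (forall i, small 2 (p i)) ->
  (forall j, digit_polys M (w j)) ->
  (forall i j, (i < j)%N -> digit_polys M (p i + w j)) ->
  (forall i j, (j < i)%N -> ~ digit_polys M (p i + w j)) ->
  order_property M.
Proof.
move=> ft psm wM pwM npw; have [U UU Uoo] := free_ultrafilter.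
have [n|W Wlim] := @boolp.choice nat int (fun n c => U [set k | (w k)`_n = c]).
  by apply: (@ultra_int_limit _ _ 1) => k; exact: (digit_polys_small (wM k)).
have [n|Q Qlim] := @boolp.choice nat int (fun n c => U [set k | (p k)`_n = c]).
  by apply: (@ultra_int_limit _ _ 2) => k; exact: psm.
pose agree N :=
  [set k | forall n, (n < N)%N -> (p k)`_n = Q n /\ (w k)`_n = W n].
have Uagree N : U (agree N).
  elim: N => [|N IH]; first by apply: filterE => k n.
  apply: filterS (filterI IH (filterI (Qlim N) (Wlim N))) => k [kN [kQ kW]] n.
  by rewrite ltnS leq_eqVlt => /orP[/eqP->|/kN].
have [N1 W0] : exists N, forall n, (N <= n)%N -> W n = 0.
  apply: (chain_finite ft) => N.
  have [k kN] := @filter_ex _ U _ _ (Uagree N).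
  apply: label_le (wM k).2; apply: lenvec_le => n; rewrite coef_poly.
  by case: ltnP => // /kN[_ ->].
have [N2 QW0] : exists N, forall n, (N <= n)%N -> Q n + W n = 0.
  apply: (chain_finite ft) => N.
  have [i iN] := @filter_ex _ U _ _ (Uagree N).
  have [j [jN ij]] := @filter_ex _ U _ _ (filterI (Uagree N) (Uoo i.+1)).
  apply: label_le (pwM i j ij).2; apply: lenvec_le => n; rewrite coef_poly.
  by case: ltnP => // nN; rewrite coefD (iN n nN).1 (jN n nN).2.
pose N0 := maxn N1 N2.
have {}W0 n : (N0 <= n)%N -> W n = 0 by rewrite geq_max => /andP[/W0].
have Q0 n : (N0 <= n)%N -> Q n = 0.
  by move=> Nn; move: (Nn); rewrite geq_max => /andP[_ /QW0]; rewrite W0 ?addr0.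
have [s|s sQ sP] := @pairwise_sequence nat (agree N0)
    (fun k k' => (k < k')%N /\ agree (maxn (size (p k)) (size (w k))) k').
  move=> _; suff Us : U [set k' | {in s, forall k, (k < k')%N /\
      agree (maxn (size (p k)) (size (w k))) k'}].
    have [k [kN ks]] := @filter_ex _ U _ _ (filterI (Uagree N0) Us).
    by exists k.
  elim: s => [|k s IH]; first by apply: filterE => k' k.
  apply: filterS (filterI (filterI (Uoo k.+1)
    (Uagree (maxn (size (p k)) (size (w k))))) IH) => k' [[/= kk' ak] as' k0].
  by rewrite inE => /orP[/eqP->|/as'].
have sN i n : (n < N0)%N -> (p (s i))`_n = Q n /\ (w (s i))`_n = W n.
  exact: sQ.
pose C := \poly_(n < N0) (Q n + W n).
pose p' i := p (s i) - \poly_(n < N0) Q n.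
pose w' j := w (s j) - \poly_(n < N0) W n.
have p'E i n : (p' i)`_n = if (n < N0)%N then 0 else (p (s i))`_n.
  rewrite coefB coef_poly.
  by case: ltnP => [/(sN i)[-> _]|_]; rewrite ?subrr ?subr0.
have w'E j n : (w' j)`_n = if (n < N0)%N then 0 else (w (s j))`_n.
  rewrite coefB coef_poly.
  by case: ltnP => [/(sN j)[_ ->]|_]; rewrite ?subrr ?subr0.
have dec i j : p (s i) + w (s j) = C + (p' i + w' j).
  apply/polyP => n.
  rewrite coefD (coefD C) (coefD (p' i)) p'E w'E coef_poly.
  case: ltnP => [nN|_]; last first.
    by rewrite add0r.
  by rewrite (sN i n nN).1 (sN j n nN).2 addr0.
have dis i j : i != j -> forall n, (p' i)`_n = 0 \/ (w' j)`_n = 0.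
  move=> ij n; rewrite p'E w'E; have [nN|Nn] := ltnP n N0; first by left.
  move: ij; rewrite neq_ltn => /orP[/sP[_ ij]|/sP[_ ji]].
    have [/ij[_ ->]|ni] := ltnP n (maxn (size (p (s i))) (size (w (s i)))).
      by right; rewrite W0.
    by left; rewrite nth_default // (leq_trans _ ni) // leq_maxl.
  have [/ji[-> _]|ni] := ltnP n (maxn (size (p (s j))) (size (w (s j)))).
    by left; rewrite Q0.
  by right; rewrite nth_default // (leq_trans _ ni) // leq_maxr.
have disC i j n : C`_n = 0 \/ (p' i + w' j)`_n = 0.
  rewrite (coefD (p' i)) coef_poly p'E w'E; case: ltnP => _; last by left.
  by right; rewrite addr0.
have len i j : i != j ->
    lenvec (p (s i) + w (s j)) = lenvec C + lenvec (p' i) + lenvec (w' j).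
  by move=> ij; rewrite dec (lenvecD (disC i j)) (lenvecD (dis i j ij)) addrA.
(* Pairing [p (s i)] with the next [w] shows its digits beyond [N0] to be
   admissible, since the partner vanishes wherever [p (s i)] does not. *)
have pE i n : (N0 <= n)%N -> E (p (s i))`_n.
  move=> Nn; have ii : i != i.+1 by rewrite ltn_eqF.
  have [pE _] := pwM _ _ (sP i i.+1 (ltnSn i)).1.
  have := dis _ _ ii n; rewrite p'E w'E ltnNge Nn /= => -[->//|w0].
  by have := pE n; rewrite coefD w0 addr0.
have digE i j : i != j -> forall n, E (p (s i) + w (s j))`_n.
  move=> ij n; have [nN|Nn] := ltnP n N0.
    have [pwE _] := pwM _ _ (sP i i.+1 (ltnSn i)).1.
    have := pwE n; rewrite !coefD.
    by rewrite (sN i.+1 n nN).2 (sN j n nN).2.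
  have := dis _ _ ij n; rewrite p'E w'E ltnNge Nn /= coefD => -[->|->].
    by rewrite add0r; have [] := wM (s j).
  by rewrite addr0; exact: pE.
exists (fun i => lenvec C + lenvec (p' i)), (fun j => lenvec (w' j)).
split=> i j ij.
  by rewrite -len ?ltn_eqF //; have [] := pwM _ _ (sP _ _ ij).1.
move=> Mij; apply: (npw (s i) (s j)); first by have [] := sP _ _ ij.
split; first by apply: digE; rewrite gtn_eqF.
by rewrite len // gtn_eqF.
Qed.

(** Subtracting [t 0] turns every [u j] with [j > 0] into an expansion and every
[t i] with [i > 0] into a difference of two expansions, and by uniqueness the
equations between the integers then hold between the polynomials.  The indices
are shifted by one to drop the index 0. *)
Lemma order_ints_label M : label_finite_type M ->
  order_property (digit_ints M) -> order_property M.
Proof.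
move=> ft [t [u [tu ntu]]].
have [[i j]|v vP] := @boolp.choice (nat * nat)%type {poly int} (fun ij p =>
    (ij.1 < ij.2)%N -> digit_polys M p /\ p.[b] = t ij.1 + u ij.2).
  case: (ltnP i j) => [ij|ji]; last by exists 0 => /= ij; lia.
  by have [p Mp pE] := tu i j ij; exists p.
have vM i j : (i < j)%N -> digit_polys M (v (i, j)) by move=> /(vP (i, j))[].
have vb i j : (i < j)%N -> (v (i, j)).[b] = t i + u j by move=> /(vP (i, j))[].
pose w j := v (0%N, j.+1).
pose p i := v (i.+1, i.+2) - v (0%N, i.+2).
have wM j : digit_polys M (w j) by exact: vM.
have psm i : small 2 (p i).
  move=> n; rewrite coefB; apply: le_trans (ler_normB _ _) _.
  have s1 := digit_polys_small (vM i.+1 i.+2 (ltnSn _)) n.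
  have s2 := digit_polys_small (vM 0%N i.+2 isT) n.
  exact: lerD s1 s2.
have pwb i j : (p i + w j).[b] = t i.+1 + u j.+1.
  by rewrite !hornerD hornerN !vb //; ring.
apply: (@order_digit_polys M p w) => // i j ij.
  have -> : p i + w j = v (i.+1, j.+1); last by apply: vM.
  have vs : small 1 (v (i.+1, j.+1)) by apply: digit_polys_small; apply: vM.
  have ws := digit_polys_small (wM j).
  suff : p i = v (i.+1, j.+1) - w j by move=> ->; rewrite subrK.
  apply: horner_inj_small => //.
    move=> n; rewrite coefB; apply: le_trans (ler_normB _ _) _.
    exact: lerD (vs n) (ws n).
  by rewrite hornerD hornerN vb // -pwb hornerD addrK.
by move=> Mpw; apply: (ntu i.+1 j.+1) => //; rewrite -pwb; exists (p i + w j).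
Qed.

Lemma digit_ints_stable M :
  (label_bounded M /\ ~ order_property M) <-> ~ order_property (digit_ints M).
Proof.
split=> [[bd nop]|nop].
  by move=> /(order_ints_label (bounded_stable_finite_type bd nop)).
split; last by move=> /order_label_ints.
by apply: contrapT => /unbounded_order.
Qed.

End Alphabet.
End Digits.

(** * Expansions of integers and the subshifts of a label *)

Lemma partition_level (D : posnat -> set nat) : length_partition D ->
  exists lev : nat -> posnat, (forall l i, D l i.+1 <-> lev i = l) /\
    (forall l N, exists2 i, (N <= i)%N & lev i = l).
Proof.
move=> [inf triv cover _].
have [i|lev levP] := @boolp.choice nat posnat (fun i l => D l i.+1).
  have : (\bigcup_l D l) i.+1 by rewrite cover.
  by move=> [l _ Dl]; exists l.
have levE l i : D l i.+1 <-> lev i = l.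
  split=> [Dl|<- //]; apply: (triv (lev i) l) => //.
  by exists i.+1; split.
exists lev; split=> // l N; apply: contrapT => nN; apply: (inf l).
apply: (sub_finite_set (B := `I_N.+1)); last exact: finite_II.
move=> n Dn; have : (\bigcup_l D l) n by exists l.
rewrite cover /=; case: n Dn => // n /levE ln _; rewrite ltnS ltnNge.
by apply/negP => Nn; apply: nN; exists n.
Qed.

Section Conversion.
Variables (b : nat) (D : posnat -> set nat) (lev : nat -> posnat).
Hypothesis b_ge5 : (5 <= b)%N.
Hypothesis levE : forall l i, D l i.+1 <-> lev i = l.

Local Notation "p .[b]" := (horner p b%:Z) (at level 2, format "p .[b]").

Lemma kseqP (j : int) : j != 0 ->
  kseq b j = (sgz j *: 'X^(`|j|.-1)).[b].
Proof.
by rewrite hornerZ hornerXn; case: j => [[|n]|n] //= _;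
  rewrite ?mul1r ?mulN1r ?NegzE //= sgzN sgz_def.
Qed.

Lemma level_mem l (j : int) : j != 0 ->
  (`|j|%N \in D l) = (lev `|j|.-1 == l).
Proof.
move=> j0; have : (0 < `|j|)%N by rewrite absz_gt0.
case: (`|j|%N) => // n _ /=.
by apply/idP/eqP => [/set_mem/levE|/levE/mem_set].
Qed.

(** The positions strictly decrease along the list, so distinct terms contribute
to distinct coefficients. *)
Lemma polynomial_of_expansion (js : seq int) (t : int) : expansion b js t ->
  exists p : {poly int}, [/\ small 1 p, p.[b] = t &
    forall l, lenvec lev p l = count (fun j => `|j|%N \in D l) js].
Proof.
move=> [srt nz ->].
suff [p [p1 pt pl _]] : exists p : {poly int}, [/\ small 1 p, p.[b] = \sum_(j <- js) kseq b j,
    forall l, lenvec lev p l = count (fun j => `|j|%N \in D l) js &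
    forall i, p`_i != 0 -> exists2 j, j \in js & i.+1 = `|j|%N].
  by exists p.
elim: js srt nz => [|j js IH].
  exists 0; split=> [i||l|i]; rewrite ?coef0 ?horner0 ?big_nil ?lenvec0 //.
  by rewrite mset0E.
rewrite /= => srt /andP[j0 nz].
have [p [p1 pt pl pjs]] := IH (path_sorted srt) nz.
have j1 : (`|j|.-1.+1 = `|j|)%N by rewrite prednK // absz_gt0.
have pj : p`_(`|j|.-1) = 0.
  apply/eqP/negPn/negP => /pjs[j' j's]; rewrite j1 => jj'.
  have /(order_path_min (rev_trans ltn_trans)) /allP := srt.
  by move=> /(_ _ (map_f _ j's)); rewrite /= jj' ltnn.
have dis i : (sgz j *: 'X^(`|j|.-1) : {poly int})`_i = 0 \/ p`_i = 0.
  rewrite coefZ coefXn; case: eqP => [->|_]; first by right.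
  by left; rewrite mulr0.
exists (sgz j *: 'X^(`|j|.-1) + p); split=> [i||l|i].
- rewrite coefD; case: (dis i) => ->; first by rewrite add0r.
  rewrite addr0 coefZ coefXn normrM; case: eqP => _.
    by case: sgzP.
  by rewrite normr0 mulr0.
- by rewrite hornerD pt big_cons kseqP.
- rewrite lenvecD // lenvecZXn ?sgz_eq0 // NvecD pl level_mem //= msetnE.
  by rewrite eq_sym; case: eqP.
- rewrite coefD coefZ coefXn; have [-> _|_] := eqVneq i `|j|.-1.
    by exists j; rewrite ?mem_head.
  rewrite mulr0 add0r => /pjs[j' j's ->]; exists j' => //.
  by rewrite inE j's orbT.
Qed.

Lemma truncS (p : {poly int}) N :
  \poly_(i < N.+1) p`_i = \poly_(i < N) p`_i + p`_N *: 'X^N.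
Proof. by rewrite !poly_def big_ord_recr. Qed.

Lemma trunc_disjoint (p : {poly int}) N i :
  (\poly_(i < N) p`_i)`_i = 0 \/ (p`_N *: 'X^N)`_i = 0.
Proof.
rewrite coef_poly coefZ coefXn; case: ltnP => iN; last by left.
by right; rewrite ltn_eqF // mulr0.
Qed.

Lemma expansion_of_polynomial (p : {poly int}) : small 1 p ->
  exists2 js, expansion b js p.[b] &
    forall l, lenvec lev p l = count (fun j => `|j|%N \in D l) js.
Proof.
move=> p1; rewrite -[p in p.[b]]coefK -[p in lenvec _ p]coefK.
suff [js [js1 js2 _]] : exists js,
    [/\ expansion b js (\poly_(i < size p) p`_i).[b],
     forall l, lenvec lev (\poly_(i < size p) p`_i) l =
                count (fun j => `|j|%N \in D l) js &
     all (fun j => (`|j| <= size p)%N) js] by exists js.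
elim: (size p) => [|N [js [[srt nz sm] cnt bnd]]].
  exists [::]; rewrite poly_def big_ord0; split=> // [|l].
    by split=> //; rewrite horner0 big_nil.
  by rewrite lenvec0 mset0E.
have bnd' : all (fun j : int => (`|j| <= N.+1)%N) js.
  by apply: sub_all bnd => j /leqW.
rewrite truncS; have [pN|pN] := eqVneq p`_N 0.
  exists js; rewrite pN scale0r addr0; split=> //.
have [sN aN] : sgz (p`_N * N.+1%:Z) = p`_N /\ absz (p`_N * N.+1%:Z) = N.+1.
  move: (p1 N) pN; case: (p`_N) => [[|[|n]]|[|n]] //= _ _; lia.
set j := p`_N * N.+1%:Z in sN aN.
have j0 : j != 0 by rewrite -absz_eq0 aN.
exists (j :: js); split.
- split=> /=; last by rewrite big_cons kseqP // sN aN hornerD addrC sm.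
  + rewrite path_min_sorted ?srt //; apply/allP => _ /mapP[k kjs ->].
    by rewrite /= aN ltnS (allP bnd).
  + by rewrite j0.
- move=> l; rewrite lenvecD; last exact: trunc_disjoint.
  rewrite NvecD cnt lenvecZXn //= level_mem // aN msetnE eq_sym addnC.
  by case: eqP.
- by rewrite /= aN leqnn.
Qed.

(** The absolute values of the terms increase with the position, so distinct
positions contribute distinct elements to the finite set. *)
Lemma IP_horner (J : set int) (p : {poly int}) :
  (forall i, p`_i != 0 -> (kseq b @` J) (p`_i * b%:Z ^+ i)) -> small 1 p ->
  IP b J p.[b].
Proof.
move=> pJ p1; rewrite -[p]coefK.
suff [F [FJ Fs _]] : exists F : {fset int}, [/\ [set` F] `<=` kseq b @` J,
   (\poly_(i < size p) p`_i).[b] = \sum_(x <- F) x &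
   {in F, forall x, (`|x| < b%:Z ^+ size p)}] by exists F.
have b0 : 0 < b%:Z by lia.
elim: (size p) => [|N [F [FJ Fs Fb]]].
  exists fset0; split=> [x|//|//]; rewrite ?inE //.
  by rewrite poly_def big_ord0 horner0 big_seq_fset0.
have bN : b%:Z ^+ N < b%:Z ^+ N.+1.
  by rewrite exprS ltr_pMl ?exprn_gt0 //; lia.
have Fb' : {in F, forall x, `|x| < b%:Z ^+ N.+1}.
  by move=> x /Fb xb; apply: lt_trans bN.
rewrite truncS; have [pN|pN] := eqVneq p`_N 0.
  by exists F; rewrite pN scale0r addr0.
have xN : `|p`_N * b%:Z ^+ N| = b%:Z ^+ N.
  have -> : `|p`_N * b%:Z ^+ N| = `|p`_N| * b%:Z ^+ N.
    by rewrite normrM (ger0_norm (exprn_ge0 _ (ltW b0))).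
  suff -> : `|p`_N| = 1 by rewrite mul1r.
  by move: (p1 N) pN; case: (p`_N) => [[|[|n]]|[|n]].
exists (p`_N * b%:Z ^+ N |` F)%fset; split.
- move=> x /=; rewrite !inE => /orP[/eqP->|xF]; first exact: pJ.
  exact: FJ.
- rewrite big_fsetU1 /=; last by apply/negP => /Fb; rewrite xN ltxx.
  by rewrite hornerD Fs addrC hornerZ hornerXn.
- by move=> x; rewrite !inE => /orP[/eqP->|/Fb'//]; rewrite xN.
Qed.

Lemma IP_pos_digits01 (t : int) : IP b [set j | 0 <= j] t ->
  exists2 p : {poly int}, digits01 p & p.[b] = t.
Proof.
move=> [F FJ ->]; have /= := fset_uniq F.
have FJ' : {in F, forall x, x = 0 \/ exists n, x = b%:Z ^+ n}.
  by move=> x /FJ[[[|n]|n] //= _ <-]; [left|right; exists n].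
suff H (s : seq int) : {in s, forall x, x = 0 \/ exists n, x = b%:Z ^+ n} ->
    uniq s -> exists p : {poly int}, [/\ digits01 p, p.[b] = \sum_(x <- s) x &
      forall i, p`_i != 0 -> b%:Z ^+ i \in s].
  by move=> u; have [p [p01 ps _]] := H (enum_fset F) FJ' u; exists p.
elim: s => [_ _|x s IH sJ /= /andP[xs us]].
  exists 0; split=> [i||i]; rewrite ?coef0 ?horner0 ?big_nil ?eqxx //; by left.
have [p [p01 pt ps]] := IH (fun k kt => sJ k (mem_behead (s := x :: s) kt)) us.
have [x0|[n xn]] := sJ x (mem_head _ _).
  exists p; split=> //; first by rewrite big_cons x0 add0r.
  by move=> i /ps; rewrite inE => ->; rewrite orbT.
(* [b ^ n] does not occur in [s], so there is no digit at [n] yet. *)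
have pn : p`_n = 0.
  by apply/eqP/negPn/negP => /ps; rewrite -xn (negbTE xs).
have dis i : ('X^n : {poly int})`_i = 0 \/ p`_i = 0.
  by rewrite coefXn; case: eqP => [->|]; [right|left].
exists ('X^n + p); split.
- exact: digits01D (digits01Xn _) p01.
- by rewrite hornerD hornerXn pt big_cons xn.
- move=> i; rewrite coefD coefXn inE xn; have [->|_] := eqVneq i n.
    by rewrite eqxx.
  by rewrite add0r => /ps ->; rewrite orbT.
Qed.

Lemma label_ints_digits M :
  label_ints b D M = digit_ints lev b signed_digit M.
Proof.
apply/seteqP; split=> t.
  move=> [_ [r [js /polynomial_of_expansion[p [p1 pt pl]] rl] Mr]].
  exists p => //; split=> //; suff -> : lenvec lev p = r by [].
  by apply/msetP => l; rewrite pl rl.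
move=> [p [p1 Mp] <-]; split.
  apply: IP_horner => // i pi.
  have b0 : 0 < b%:Z by lia.
  move: (p1 i) pi; rewrite /signed_digit.
  case: (p`_i) => [[|[|n]]|[|n]] // _ _.
    by exists (i.+1%:Z) => //=; rewrite mul1r.
  by exists (Negz i) => //=; rewrite mulN1r.
have [js js1 js2] := expansion_of_polynomial p1.
by exists (lenvec lev p) => //; exists js.
Qed.

(** A sum of distinct values of [k] at nonnegative indices has an expansion with
digits 0 and 1, which is the only expansion with digits -1, 0, 1. *)
Lemma label_ints_pos_digits M :
  label_ints_pos b D M = digit_ints lev b unsigned_digit M.
Proof.
rewrite /label_ints_pos label_ints_digits; apply/seteqP; split=> t.
  move=> [[p [p1 Mp] <-] /IP_pos_digits01[q q01 qp]].
  have e : q = p.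
    apply: horner_inj_small qp => //; last exact: small12.
    exact/small12/digits01_small.
  by exists p => //; split=> // i; rewrite -e; exact: q01.
move=> [p [p01 Mp] <-]; have p1 : small 1 p by exact: digits01_small.
split; first by exists p.
apply: IP_horner => // i; case: (p01 i) => -> // _.
by exists (i.+1%:Z) => //=; rewrite mul1r.
Qed.

End Conversion.

Theorem theorem4p19 (R : realType) (b : nat) (D : posnat -> set nat)
    (b_odd : odd b) (b_ge5 : (5 <= b)%N) (D_part : length_partition D)
    (M : label) :
  [/\ label_bounded M /\ label_WAP R M <-> cascade_WAP b D M,
      cascade_WAP b D M <-> cascade_pos_WAP b D M &
      label_bounded M /\ label_WAP R M ->
        [/\ countable (Theta R M), countable (X_of b D M) &
            label_finite_type M]].
Proof.
have [lev [levE lev_inf]] := partition_level D_part.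
have ints : label_bounded M /\ ~ order_property M <-> cascade_WAP b D M.
  rewrite /cascade_WAP char_seq_WAP_order (label_ints_digits b_ge5 levE).
  exact: digit_ints_stable.
have ints_pos : label_bounded M /\ ~ order_property M <-> cascade_pos_WAP b D M.
  rewrite /cascade_pos_WAP char_seq_WAP_order.
  rewrite (label_ints_pos_digits b_ge5 levE).
  by apply: digit_ints_stable => //; [left|right|move=> c [->|->]].
have lab : label_bounded M /\ label_WAP R M <->
    label_bounded M /\ ~ order_property M by rewrite label_WAP_order.
split=> [||/lab[bd nop]]; first exact: iff_trans lab ints.
  exact: iff_trans (iff_sym ints) ints_pos.
split; [exact: Theta_countable| |exact: bounded_stable_finite_type].
have /ints := conj bd nop; rewrite /cascade_WAP char_seq_WAP_order.
exact: char_seq_orbit_countable.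
Qed.
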